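(* Let $(T,\Lambda,m,I,(\Psi_\lambda)_{\lambda\in\Lambda})$ be a random conformal iterated function system. If the alphabet $I$ is infinite, assume that \[\sup_{i\in I}\frac{\overline M_i}{\underline M_i}<\infty.\] Then for $m$-almost every $\lambda\in\Lambda$, \[\operatorname{HD}(J(\Phi_\lambda))=\inf\{t\ge0:\mathcal EP(t)\le0\}.\]
   Context: Fix $d\in\mathbb N$ and a compact set $X\subset\mathbb R^d$ equal to the closure of its interior, with $\partial X$ smooth or $X$ convex. $\|D\phi\|:=\sup_{x\in X}|\phi'(x)|$ for a conformal map $\phi$. A random conformal iterated function system consists of: - an invertible ergodic transformation $T:\Lambda\to\Lambda$ preserving a probability measure $m$ on a measure space $\Lambda$; - a finite or countably infinite alphabet $I$; - for every $\lambda\in\Lambda$, a family $\Psi_\lambda=\{\phi^\lambda_i:i\in I\}$ of maps $X\to X$ such that $\lambda\mapsto\phi^\lambda_i(x)$ is measurable for every $i$ and $x$. For each $\lambda$, the non-autonomous system $\Phi_\lambda$ has levels $\Phi_\lambda^{(n)}=\{\phi_i^{T^n(\lambda)}:i\in I\}$. It is assumed that every $\Phi_\lambda$ is an NCIFS on $X$, with one common open set $V$ and common constants $K,\eta$. That is: - images of $\operatorname{int}X$ under distinct maps of the same level are disjoint; - all maps extend to $C^1$ conformal diffeomorphisms of an open connected $V\supset X$ into $V$; - every finite composition $\phi$ of consecutive-level maps satisfies $|\phi'(x)|\le K|\phi'(y)|$ on $V$; - $\|D\phi\|\le\eta<1$ for every map. For an NCIFS $\Phi$ with levels $\Phi^{(j)}=(\phi^{(j)}_i)_{i\in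 I}$, let $\phi_\omega=\phi^{(1)}_{\omega_1}\circ\cdots\circ\phi^{(n)}_{\omega_n}$ for $\omega\in I^n$. Define $J(\Phi)=\bigcap_n\bigcup_{\omega\in I^n}\phi_\omega(X)$ and $\underline P^\Phi(t)=\liminf_n\frac1n\log\sum_{\omega\in I^n}\|D\phi_\omega\|^t$. The expected pressure $\mathcal EP(t)$ is the expected value of $\underline P^{\Phi_\lambda}(t)$ (which is $m$-a.e. constant in $\lambda$). Set $\underline M_i=\operatorname{ess\,inf}_\lambda\|D\phi^\lambda_i\|$ and $\overline M_i=\operatorname{ess\,sup}_\lambda\|D\phi^\lambda_i\|$. $\operatorname{HD}$ is Hausdorff dimension. *)

(* Defs.v *)
From HB Require Import structures.
From mathcomp Require Import all_boot all_order all_algebra.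
From mathcomp Require Import all_classical all_reals all_analysis ess_sup_inf.
Set Implicit Arguments. Unset Strict Implicit. Unset Printing Implicit Defensive.
Import Order.TTheory GRing.Theory Num.Def Num.Theory.
Import numFieldNormedType.Exports.
Local Open Scope classical_set_scope.
Local Open Scope ring_scope.

Section Euclidean.
Context {R : realType} {d : nat}.
Local Notation V := 'rV[R]_d.

(** Euclidean norm on R^d (the matrix norm of mathcomp is the sup norm). *)
Definition enorm (v : V) : R := Num.sqrt (\sum_(i < d) v ord0 i ^+ 2).

(** Euclidean diameter, in the extended reals, with diam(emptyset) = 0. *)
Definition ediam (A : set V) : \bar R :=
  maxe 0%E (ereal_sup [set (enorm (x - y))%:E | x in A & y in A]).

(** x^s for x in [0, +oo] and s > 0. *)
Definition epow (x : \bar R) (s : R) : \bar R :=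
  match x with
  | EFin r => (r `^ s)%:E
  | +oo%E => +oo%E
  | -oo%E => 0%E
  end.

Definition hausdorff_delta (s delta : R) (A : set V) : \bar R :=
  ereal_inf [set (\sum_(0 <= k <oo) epow (ediam (U k)) s)%E |
     U in [set U : nat -> set V |
             A `<=` \bigcup_k U k /\ forall k, (ediam (U k) <= delta%:E)%E]].

(** s-dimensional Hausdorff (outer) measure: limit (= sup) as delta -> 0+. *)
Definition hausdorff_measure (s : R) (A : set V) : \bar R :=
  ereal_sup [set hausdorff_delta s delta A | delta in [set delta : R | 0 < delta]].

Definition hausdorff_dim (A : set V) : \bar R :=
  ereal_inf [set s%:E | s in [set s : R | 0 < s /\ hausdorff_measure s A = 0%E]].

Definition dnorm (f : V -> V) (x : V) : R :=
  sup [set enorm ('d f x u) | u in [set u : V | enorm u <= 1]].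

Definition Dnorm (X : set V) (f : V -> V) : R := sup [set dnorm f x | x in X].

Definition C1_on (U : set V) (f : V -> V) : Prop :=
  (forall x, U x -> differentiable f x) /\
  (forall (u : V) x, U x -> {for x, continuous (fun y => 'd f y u)}).

Definition conformal_diffeo_into (U : set V) (f : V -> V) : Prop :=
  [/\ f @` U `<=` U /\ open (f @` U),
      (forall x y, U x -> U y -> f x = f y -> x = y),
      C1_on U f,
      (exists g : V -> V, (forall x, U x -> g (f x) = x) /\ C1_on (f @` U) g) &
      (forall x, U x -> exists c : R, 0 < c /\ forall u, enorm ('d f x u) = c * enorm u)].

Fixpoint Ck (k : nat) (U : set V) (g : V -> R) : Prop :=
  match k with
  | 0%N => forall x, U x -> {for x, continuous g}
  | k'.+1 => (forall x, U x -> differentiable g x) /\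
             (forall i : 'I_d, Ck k' U (fun x => 'D_(delta_mx 0 i) g x))
  end.

Definition smooth_boundary (X : set V) : Prop :=
  forall p, closure X p -> ~ interior X p ->
    exists (U : set V) (g : V -> R),
      [/\ open U, U p, (forall k, Ck k U g),
          (exists i : 'I_d, 'D_(delta_mx 0 i) g p != 0) &
          X `&` U = [set x | U x /\ g x <= 0]].

Definition convex_body (X : set V) : Prop :=
  forall x y (t : R), X x -> X y -> 0 <= t <= 1 -> X ((1 - t) *: x + t *: y).

Context {I : Type}.

(** For a non-autonomous system with levels Phi j (j >= 1), the composition
    Phi (j+1) w_1 o Phi (j+2) w_2 o ... o Phi (j+n) w_n. *)
Fixpoint compL (Phi : nat -> I -> V -> V) (j : nat) (w : seq I) : V -> V :=
  match w with
  | [::] => id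
  | a :: w' => Phi j.+1 a \o compL Phi j.+1 w'
  end.

Definition NCIFS (X Vs : set V) (K eta : R) (Phi : nat -> I -> V -> V) : Prop :=
  [/\ (forall j i, (0 < j)%N -> Phi j i @` X `<=` X),
      (forall j i i', (0 < j)%N -> i <> i' ->
          Phi j i @` interior X `&` Phi j i' @` interior X = set0),
      [/\ open Vs, connected Vs & X `<=` Vs] /\
      (forall j i, (0 < j)%N -> conformal_diffeo_into Vs (Phi j i)),
      (forall j (w : seq I) x y, w <> [::] -> Vs x -> Vs y ->
          dnorm (compL Phi j w) x <= K * dnorm (compL Phi j w) y) &
      ((forall j i x, (0 < j)%N -> X x -> dnorm (Phi j i) x <= eta) /\
      eta < 1)].

Definition limit_set (X : set V) (Phi : nat -> I -> V -> V) : set V :=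
  \bigcap_n \bigcup_(w in [set w : seq I | size w = n]) (compL Phi 0 w @` X).

End Euclidean.

Definition eln {R : realType} (x : \bar R) : \bar R :=
  match x with
  | EFin r => if 0 < r then (ln r)%:E else -oo%E
  | +oo%E => +oo%E
  | -oo%E => -oo%E
  end.

Definition lower_pressure {R : realType} {d : nat} {I : countType}
    (X : set 'rV[R]_d) (Phi : nat -> I -> 'rV[R]_d -> 'rV[R]_d) (t : R) : \bar R :=
  limn_einf (fun n : nat =>
    ((n%:R)^-1)%:E *
      eln (\esum_(w in [set w : seq I | size w = n])
              ((Dnorm X (compL Phi 0 w)) `^ t)%:E))%E.

Definition Phi_of {Lam I V : Type} (T : Lam -> Lam) (phi : Lam -> I -> V -> V)
    (lam : Lam) : nat -> I -> V -> V :=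
  fun n => phi (iter n T lam).

Definition expected_pressure {R : realType} {d : nat} {I : countType}
    {dL : measure_display} {Lam : measurableType dL} (m : probability Lam R)
    (T : Lam -> Lam) (X : set 'rV[R]_d) (phi : Lam -> I -> 'rV[R]_d -> 'rV[R]_d)
    (t : R) : \bar R :=
  (\int[m]_lam lower_pressure X (Phi_of T phi lam) t)%E.

Definition invertible_mpt {R : realType} {dL : measure_display}
    {Lam : measurableType dL} (m : probability Lam R) (T : Lam -> Lam) : Prop :=
  [/\ measurable_fun setT T,
      (exists Tinv : Lam -> Lam, [/\ cancel T Tinv, cancel Tinv T &
                                     measurable_fun setT Tinv]) &
      (forall A, measurable A -> m (T @^-1` A) = m A)].

Definition ergodic {R : realType} {dL : measure_display}
    {Lam : measurableType dL} (m : probability Lam R) (T : Lam -> Lam) : Prop :=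
  forall A, measurable A -> T @^-1` A = A -> m A = 0%E \/ m A = 1%E.

Definition M_lower {R : realType} {d : nat} {I : Type}
    {dL : measure_display} {Lam : measurableType dL} (m : probability Lam R)
    (X : set 'rV[R]_d) (phi : Lam -> I -> 'rV[R]_d -> 'rV[R]_d) (i : I) : \bar R :=
  ess_inf m (fun lam => (Dnorm X (phi lam i))%:E).

Definition M_upper {R : realType} {d : nat} {I : Type}
    {dL : measure_display} {Lam : measurableType dL} (m : probability Lam R)
    (X : set 'rV[R]_d) (phi : Lam -> I -> 'rV[R]_d -> 'rV[R]_d) (i : I) : \bar R :=
  ess_sup m (fun lam => (Dnorm X (phi lam i))%:E).

(* Main.v *)
(** Write [D(w)] for the derivative norm of the composition [phi_w] and [Z_n(t)] for the sum of
    [D(w)^t] over words of length [n]; bounded distortion makes [D] multiplicative up to the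
    factor [K].

    Upper bound: the cylinders [phi_w(X)] have diameter [O(D(w))], so covers by the n-th
    level show that [P(q) <= 0 < s - q] forces the s-dimensional measure to vanish.

    Lower bound: if [P(t) > 0], some finite subalphabet [F] still has [Z_n^F(t)] growing
    exponentially. When the sum of the [M_i^t] is infinite this is immediate; when it is
    finite, the comparability of the [D] on letters makes the proportion of mass lost by
    replacing one letter of [I] by a letter of [F] at most [e], uniformly in the prefix
    and in the parameter, so [Z_n^F >= (1 - e)^n Z_n]. For a finite alphabet, give each
    word of length [n] the mass [D(w)^t / Z_n]. Cutting words when [D] falls below [r],
    boundedly many words per level meet a ball of radius [r] (interior cone
    condition on [X]), and the children of level [k] have mass [O(r^t / Z_k)]; since [Z_k]
    grows exponentially the ball has mass [O(r^t)]. By compactness a cover of the limit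
    set already covers a finite level, so no limiting measure is needed.

    Randomness: the sign of the pressure is invariant under [T] almost everywhere, hence
    almost everywhere constant by ergodicity, and it is the sign of its expectation.
    No ergodic theorem is used. *)

(* Conformality refers to the Euclidean norm, while the topology is that of the sup norm; [sqrtdim]
   converts between the two and enters most later constants. Separating cylinders requires the image
   of a ball to contain a ball of controlled radius. An inverse function theorem would give a radius
   depending on the map, so a minimisation argument is used, whose radius depends only on the lower
   bound of the derivative. Level sums run over finite duplicate-free alphabets and the sign of the
   pressure is recorded by [growth_le D t 0], so the combinatorial estimates never meet an infinite
   sum. The random parameter raises three obstacles. [Dnorm] is a supremum over an uncountable set,
   so for measurability it is replaced, up to bounded distortion, by the derivative at one interior
   point. With an infinite alphabet the first level sum could be infinite while the later ones are
   not, which would break the invariance of the sign; comparability of the letters excludes this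
   almost surely. Finally the exceptional null set must not depend on the exponent, so only rational
   exponents are used, and monotonicity fills the gaps. *)
Require Import Defs.
From HB Require Import structures.
From mathcomp Require Import all_boot all_order all_algebra.
From mathcomp Require Import all_classical all_reals all_analysis ess_sup_inf.
From mathcomp Require Import measurable_realfun.
From mathcomp Require finmap.
From mathcomp Require Import lra ring.
Set Implicit Arguments. Unset Strict Implicit. Unset Printing Implicit Defensive.
Import Order.TTheory GRing.Theory Num.Def Num.Theory.
Import numFieldNormedType.Exports.
Local Open Scope classical_set_scope.
Local Open Scope ring_scope.

(** * Euclidean and sup norms, mean value inequalities *)

Section norms.
Context {R : realType} {d : nat}.
Local Notation V := 'rV[R]_d.
Implicit Types (u v x y z : V).

Lemma coord_le_norm (v : V) (j : 'I_d) : `|v ord0 j| <= `|v|.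
Proof. by rewrite [leRHS]/normr /= mx_normrE; apply/bigmax_geP; right => /=; exists (ord0, j). Qed.

Lemma norm_le_coord (v : V) (c : R) : 0 <= c ->
  (forall j, `|v ord0 j| <= c) -> `|v| <= c.
Proof.
move=> c0 h; rewrite [leLHS]/normr /= mx_normrE; apply/bigmax_leP; split=> //.
by move=> [i j] _ /=; rewrite (ord1 i) h.
Qed.

(** The added 1 keeps the constant positive in dimension 0. *)
Definition sqrtdim : R := Num.sqrt d%:R + 1.

Lemma sqrtdim_gt0 : 0 < sqrtdim.
Proof. by rewrite /sqrtdim ltr_wpDl // sqrtr_ge0. Qed.

Lemma enorm_ge0 v : 0 <= enorm v.
Proof. exact: sqrtr_ge0. Qed.

Lemma enormZ (a : R) v : enorm (a *: v) = `|a| * enorm v.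
Proof.
rewrite /enorm (eq_bigr (fun i => a ^+ 2 * v ord0 i ^+ 2)); last first.
  by move=> i _; rewrite mxE exprMn.
by rewrite -mulr_sumr sqrtrM ?sqr_ge0 // sqrtr_sqr.
Qed.

Lemma norm_le_enorm v : `|v| <= enorm v.
Proof.
apply: norm_le_coord; first exact: enorm_ge0.
move=> j; rewrite -sqrtr_sqr ler_wsqrtr // (bigD1 j) //= lerDl.
by apply: sumr_ge0 => i _; rewrite sqr_ge0.
Qed.

Lemma enorm_le_norm v : enorm v <= sqrtdim * `|v|.
Proof.
apply: (@le_trans _ _ (Num.sqrt d%:R * `|v|)); last first.
  by rewrite ler_wpM2r // /sqrtdim lerDl.
rewrite -(normr_id v) -sqrtr_sqr -sqrtrM ?ler0n // ler_wsqrtr //.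
rewrite (le_trans (y := \sum_(i < d) `|v| ^+ 2)) //; last first.
  by rewrite sumr_const card_ord mulr_natl.
apply: ler_sum => i _; rewrite -real_normK ?num_real //.
by rewrite lerXn2r ?nnegrE // coord_le_norm.
Qed.

Lemma enorm_eq0 v : enorm v = 0 -> v = 0.
Proof.
by move=> h; apply/eqP; rewrite -normr_le0 -h norm_le_enorm.
Qed.

Lemma enorm0 : enorm (0 : V) = 0.
Proof. by rewrite -(scale0r (0 : V)) enormZ normr0 mul0r. Qed.

Lemma enorm_delta (j : 'I_d) : enorm (delta_mx ord0 j : V) = 1.
Proof.
rewrite /enorm (bigD1 j) //= big1; last first.
  by move=> i ij; rewrite mxE eqxx /= (negbTE ij) expr0n.
by rewrite mxE !eqxx expr1n addr0 sqrtr1.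
Qed.

Lemma seg_mem_ball z (s : R) x y (t : R) : `|x - z| < s -> `|y - z| < s ->
  0 <= t <= 1 -> `|x + t *: (y - x) - z| < s.
Proof.
move=> xs ys /andP[t0 t1].
have -> : x + t *: (y - x) - z = (1 - t) *: (x - z) + t *: (y - z).
  by apply/matrixP => i j; rewrite !mxE; ring.
rewrite (le_lt_trans (ler_normD _ _)) // !normrZ (ger0_norm t0) ger0_norm ?subr_ge0 //.
have [->|tn] := eqVneq t 0; first by rewrite subr0 mul1r mul0r addr0.
have : t * `|y - z| < t * s by rewrite ltr_pM2l // lt_neqAle eq_sym tn.
have : (1 - t) * `|x - z| <= (1 - t) * s by rewrite ler_wpM2l ?subr_ge0 // ltW.
by lra.
Qed.

Lemma mvt_seg (g : V -> R) x u (C : R) :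
  (forall t : R, 0 <= t <= 1 -> differentiable g (x + t *: u)) ->
  (forall t : R, 0 <= t <= 1 -> 'd g (x + t *: u) u <= C) ->
  g (x + u) - g x <= C.
Proof.
move=> dg hC.
pose h (t : R) : R := g (x + t *: u).
have dh (t : R) : 0 <= t <= 1 -> is_derive t (1 : R) h ('d g (x + t *: u) u).
  move=> t01; have dgt := dg _ t01.
  have := derivableP (@diff_derivable _ _ _ g (x + t *: u) u dgt).
  rewrite deriveE // => -[h1 h2].
  have E : (fun s : R => s^-1 *: ((h \o shift t) (s *: (1 : R)) - h t)) =
           (fun s : R => s^-1 *: ((g \o shift (x + t *: u)) (s *: u) - g (x + t *: u))).
    apply/funext => s; rewrite /h /= -[s *: 1]/(s * 1) mulr1.
    suff -> : x + (s + t) *: u = s *: u + (x + t *: u) by [].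
    by rewrite scalerDl addrCA.
  apply: DeriveDef; first by rewrite /derivable E.
  by rewrite /derive E.
have [||c cI] := @MVT_segment R h (fun t => 'd g (x + t *: u) u) 0 1 ler01.
- move=> t; rewrite in_itv /= => /andP[a b]; apply: dh.
  by rewrite (ltW a) (ltW b).
- apply: continuous_in_subspaceT => t; rewrite inE /= in_itv /= => t01.
  apply: differentiable_continuous; apply/derivable1_diffP.
  by case: (dh t t01).
rewrite /h scale1r scale0r addr0 subr0 mulr1 => ->.
by apply: hC; move: cI; rewrite in_itv.
Qed.

Lemma diff_coord (f : V -> V) x u (j : 'I_d) : differentiable f x ->
  differentiable (fun y => f y ord0 j) x /\
  'd (fun y => f y ord0 j) x u = ('d f x u) ord0 j.
Proof.
move=> df.
have dc : differentiable (fun N : V => N ord0 j) (f x) by exact: differentiable_coord.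
split; first exact: (differentiable_comp df dc).
have -> : (fun y => f y ord0 j) = (fun N : V => N ord0 j) \o f by [].
rewrite diff_comp //=.
have cl : continuous (fun N : V => N ord0 j) by exact: coord_continuous.
have L : linear (fun N : V => N ord0 j) by move=> a p q; rewrite !mxE.
pose LL := GRing.isLinear.Build _ _ _ _ _ L.
pose c : {linear V -> R} := HB.pack (fun N : V => N ord0 j) LL.
by have /= := @diff_lin _ _ _ c (f x) cl => ->.
Qed.

(** The mean value theorem fails for vector-valued maps, so it is applied to each coordinate and to
    its opposite; the sup norm reassembles the coordinate bounds without loss. *)
Lemma lip_seg (f : V -> V) x y (L : R) : 0 <= L ->
  (forall t : R, 0 <= t <= 1 -> differentiable f (x + t *: (y - x))) ->
  (forall t : R, 0 <= t <= 1 -> `|'d f (x + t *: (y - x)) (y - x)| <= L) ->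
  `|f y - f x| <= L.
Proof.
move=> L0 df hL; apply: norm_le_coord => // j; rewrite !mxE ler_norml.
have Ey : y = x + (y - x) by rewrite addrC subrK.
have A (t : R) (t01 : 0 <= t <= 1) := diff_coord (y - x) j (df t t01).
have bd (t : R) (t01 : 0 <= t <= 1) : `|'d (fun y => f y ord0 j) (x + t *: (y - x)) (y - x)| <= L.
  by rewrite (A _ t01).2 (le_trans (coord_le_norm _ _)) // hL.
apply/andP; split; last first.
  rewrite {1}Ey; apply: (@mvt_seg (fun y => f y ord0 j)) => t t01.
    exact: (A _ t01).1.
  exact: le_trans (ler_norm _) (bd _ t01).
rewrite lerNl opprB {1}Ey -[X in X - _]opprK addrC.
rewrite -[X in X <= _]/((- f (x + (y - x)) ord0 j) - (- f x ord0 j)).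
apply: (@mvt_seg (fun y => - f y ord0 j)) => t t01.
  by apply: differentiableN; exact: (A _ t01).1.
have /= -> := diffN (A _ t01).1; rewrite (le_trans (ler_norm _)) //= normrN.
exact: bd.
Qed.

End norms.

(** * Conformal maps *)

Section conformal.
Context {R : realType} {d : nat}.
Local Notation V := 'rV[R]_d.
Local Notation D := (@sqrtdim R d).
Implicit Types (u v x y z : V).

Definition conformal_at (f : V -> V) x (c : R) : Prop :=
  [/\ differentiable f x, 0 < c & forall u, enorm ('d f x u) = c * enorm u].

(** The index [i0] supplies a unit vector; in dimension 0 the supremum would be 0. *)
Lemma dnorm_conformal (i0 : 'I_d) (f : V -> V) x c :
  conformal_at f x c -> dnorm f x = c.
Proof.
move=> [_ c0 hc]; rewrite /dnorm.
have -> : [set enorm ('d f x u) | u in [set u : V | enorm u <= 1]] =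
          [set c * enorm u | u in [set u : V | enorm u <= 1]].
  by apply/seteqP; split => _ [u uu <-]; exists u => //.
apply/eqP; rewrite eq_le; apply/andP; split.
  apply: ge_sup; first by exists (c * enorm (0 : V)), 0 => //=; rewrite enorm0 ler01.
  by move=> _ [u /= u1 <-]; rewrite ler_piMr // ltW.
apply: ub_le_sup; last by exists (delta_mx ord0 i0) => //=; rewrite enorm_delta ?mulr1.
by exists c => _ [u /= u1 <-]; rewrite ler_piMr // ltW.
Qed.

Lemma conformal_comp (f g : V -> V) x c c' :
  conformal_at f (g x) c -> conformal_at g x c' -> conformal_at (f \o g) x (c * c').
Proof.
move=> [df c0 hf] [dg c0' hg]; split.
- exact: differentiable_comp.
- exact: mulr_gt0.
- by move=> u; rewrite (diff_comp dg df) [LHS]hf hg mulrA.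
Qed.

Lemma conformal_norm_le (f : V -> V) x c u : conformal_at f x c ->
  `|'d f x u| <= c * (D * `|u|).
Proof.
move=> [_ c0 hc]; rewrite (le_trans (norm_le_enorm _)) // hc ler_pM2l //.
exact: enorm_le_norm.
Qed.

(** A similarity kills only the zero vector, so its square matrix is invertible. *)
Lemma conformal_surj (f : V -> V) x c v : conformal_at f x c ->
  exists2 u, 'd f x u = v & `|u| <= D * `|v| / c.
Proof.
move=> hcf; have [df c0 hc] := hcf.
pose A := lin1_mx ('d f x).
have EA u : u *m A = 'd f x u by rewrite /A mul_rV_lin1.
have Au : A \in unitmx.
  rewrite -row_free_unit; apply: inj_row_free => u; rewrite EA => u0.
  have := hc u; rewrite u0 enorm0 => /esym/eqP; rewrite mulf_eq0 gt_eqF //=.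
  by move=> /eqP/enorm_eq0.
have E : 'd f x (v *m invmx A) = v by rewrite -EA -mulmxA mulVmx // mulmx1.
exists (v *m invmx A) => //.
rewrite ler_pdivlMr // (le_trans _ (enorm_le_norm v)) // -{2}E hc mulrC ler_pM2l //.
exact: norm_le_enorm.
Qed.

Lemma conformal_lip (f : V -> V) z (s L : R) : 0 <= L ->
  (forall x, `|x - z| < s -> exists2 c, c <= L & conformal_at f x c) ->
  forall x y, `|x - z| < s -> `|y - z| < s -> `|f x - f y| <= L * (D * `|x - y|).
Proof.
move=> L0 hf x y xs ys; rewrite distrC [`|x - y|]distrC; apply: lip_seg.
- by rewrite !mulr_ge0 // ltW // sqrtdim_gt0.
- by move=> t t01; have [c _ []] := hf _ (seg_mem_ball xs ys t01).
- move=> t t01; have [c cL hc] := hf _ (seg_mem_ball xs ys t01).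
  rewrite (le_trans (conformal_norm_le _ hc)) // ler_wpM2r //.
  by rewrite mulr_ge0 // ltW // sqrtdim_gt0.
Qed.

Lemma dist_continuous z : continuous (fun x : V => `|x - z|).
Proof.
move=> x; apply: (@continuous_comp _ _ _ (fun y : V => y - z) normr); last exact: norm_continuous.
by apply: (@cvgB _ _ _ (nbhs x) _ id (fun=> z)); [exact: cvg_id|exact: cvg_cst].
Qed.

Lemma cball_compact z (s : R) : compact [set x : V | `|x - z| <= s].
Proof.
apply: bounded_closed_compact.
  exists (`|z| + s); split; first by rewrite num_real.
  move=> M hM x /= xs; apply: le_trans (ltW hM).
  by rewrite -{1}(subrK z x) (le_trans (ler_normD _ _)) // addrC lerD2l.
rewrite (_ : [set x | _] = (fun x : V => `|x - z|) @^-1` [set r : R | r <= s]) //.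
apply: preimage_closed; last exact: closed_le.
by move=> x _; exact: dist_continuous.
Qed.

(** A minimiser of [|f x - q| + k |x - z|] on the closed ball is interior and must
    solve [f x = q]: otherwise moving in the direction ['d f x ^-1 (q - f x)]
    decreases the first term faster than the second one grows. *)
Lemma conformal_ball_image (f : V -> V) z (s c : R) q : 0 < s -> 0 < c ->
  (forall x, `|x - z| <= s -> exists2 c', c <= c' & conformal_at f x c') ->
  `|f z - q| < c / (2 * D) * s ->
  exists2 x, `|x - z| < s & f x = q.
Proof.
move=> s0 c0 hf hq.
(* A preimage [u] of [e] under the differential satisfies |u| <= D |e| / c. With this slope the
   penalty grows by at most |e|/2 per unit of step along [u], while the first term drops by at least
   3|e|/4. *)
set k := c / (2 * D).
have D0 : 0 < D by exact: sqrtdim_gt0.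
have k0 : 0 < k by rewrite /k divr_gt0 // mulr_gt0.
pose h x : R := `|f x - q| + k * `|x - z|.
pose B := [set x : V | `|x - z| <= s].
have [||x /[!inE] Bx hmin] := @compact_EVT_min _ R h B _ (@cball_compact z s).
- by exists z; rewrite /B /= subrr normr0 ltW.
- apply: continuous_in_subspaceT => x /[!inE] Bx.
  have [c' _ [/differentiable_continuous cf _ _]] := hf x Bx.
  apply: (@cvgD _ _ _ (nbhs x) _ (fun y => `|f y - q|) (fun y => k * `|y - z|)).
    by apply: (@continuous_comp _ _ _ f (fun y => `|y - q|)); [exact: cf|exact: dist_continuous].
  by apply: (@cvgM _ _ (nbhs x) _ (fun=> k) (fun y => `|y - z|)); [exact: cvg_cst|exact: dist_continuous].
(* On the sphere the penalty alone equals [k * s], but the value at the centre is smaller. *)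
have xs : `|x - z| < s.
  have hxz : h x <= h z by apply: hmin; rewrite inE /B /= subrr normr0 ltW.
  rewrite -(ltr_pM2l k0); apply: le_lt_trans hq.
  move: hxz; rewrite /h subrr normr0 mulr0 addr0; apply: le_trans.
  by rewrite lerDr.
exists x => //; apply/eqP/negPn/negP => fxq.
pose e := q - f x.
have e0 : 0 < `|e| by rewrite normr_gt0 /e subr_eq0 eq_sym.
have [c' cc' hc'] := hf x Bx.
have [u du ule] := conformal_surj e hc'.
have [df c0' _] := hc'.
have := @diff_derivable _ _ _ f x u df.
rewrite /derivable => /cvg_ex[l hl].
have El : l = e.
  by rewrite -du -deriveE //; apply/esym/cvg_lim; [exact: norm_hausdorff|exact: hl].
move: hl; rewrite El => /cvgrPdist_lt /(_ (`|e| / 4)).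
move=> /(_ (divr_gt0 e0 (ltr0n _ 4))) [del /= del0 hdel].
(* The three bounds make the difference quotient accurate to |e|/4, keep [1 - t] nonnegative, and
   keep the displaced point in the ball. *)
pose t := Num.min (del / 2) (Num.min 1 ((s - `|x - z|) / (`|u| + 1))).
have u1 : 0 < `|u| + 1 by rewrite ltr_wpDl.
have t0 : 0 < t.
  by rewrite /t !lt_min ltr01 !divr_gt0 // subr_gt0.
have t1 : t <= 1 by rewrite /t !ge_min lexx orbT.
have tdel : t < del.
  by rewrite (@le_lt_trans _ _ (del / 2)) ?ge_min ?lexx // ltr_pdivrMr // ltr_pMr // ltr1n.
have tu : t * `|u| <= s - `|x - z|.
  have : t <= (s - `|x - z|) / (`|u| + 1) by rewrite /t !ge_min lexx !orbT.
  rewrite ler_pdivlMr //; apply: le_trans.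
  by rewrite ler_pM2l // lerDl.
have /= := hdel t; rewrite sub0r normrN gtr0_norm // => /(_ tdel (lt0r_neq0 t0)) ht.
pose y := t *: u + x.
have By : B y.
  rewrite /B /= /y -addrA (le_trans (ler_normD _ _)) // normrZ gtr0_norm //.
  by move: tu; lra.
have := hmin y; rewrite inE => /(_ By); rewrite leNgt => /negP; apply.
have ey : `|f y - q| <= (1 - t) * `|e| + t * (`|e| / 4).
  have -> : f y - q = - ((1 - t) *: e) - t *: (e - t^-1 *: (f y - f x)).
    rewrite (scalerBr t e) scalerA divff ?gt_eqF // scale1r scalerBl scale1r /e.
    by apply/matrixP => i j; rewrite !mxE; ring.
  rewrite (le_trans (ler_normB _ _)) // normrN !normrZ (gtr0_norm t0) ger0_norm ?subr_ge0 //.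
  by rewrite lerD2l ler_pM2l // ltW.
have uz : `|y - z| <= `|x - z| + t * `|u|.
  by rewrite /y -addrA (le_trans (ler_normD _ _)) // normrZ gtr0_norm // [leLHS]addrC.
have ku : k * `|u| <= `|e| / 2.
  have : `|u| <= D * `|e| / c.
    apply: (le_trans ule); rewrite ler_pM2l ?mulr_gt0 // lef_pV2 ?posrE //.
  rewrite -(ler_pM2l k0) => /le_trans; apply.
  rewrite /k le_eqVlt; apply/orP; left; apply/eqP; field.
  by rewrite !gt_eqF.
rewrite /h (le_lt_trans (lerD ey (_ : _ <= k * `|x - z| + t * (`|e| / 2)))) //.
  have := ler_pM2l k0 `|y - z| (`|x - z| + t * `|u|); rewrite uz => h1.
  rewrite (@le_trans _ _ (k * (`|x - z| + t * `|u|))) // mulrDr lerD2l mulrCA.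
  by rewrite ler_pM2l.
have -> : `|f x - q| = `|e| by rewrite /e distrC.
by have : 0 < t * `|e| by [apply: mulr_gt0]; lra.
Qed.

End conformal.

(** * Uniform diameter bounds and the interior corkscrew condition *)

Section geometry.
Context {R : realType} {d : nat}.
Local Notation V := 'rV[R]_d.
Local Notation D := (@sqrtdim R d).
Implicit Types (u v x y z : V).

Lemma nbhs_normP x (A : set V) :
  nbhs x A <-> exists2 s : R, 0 < s & forall y, `|y - x| < s -> A y.
Proof.
split=> [/nbhs_ballP[s /= s0 h]|[s s0 h]].
  by exists s => // y ys; apply: h; rewrite -ball_normE /ball_ /= distrC.
apply/nbhs_ballP; exists s => //= y; rewrite -ball_normE /ball_ /= distrC; exact: h.
Qed.

Lemma open_normP (A : set V) x : open A -> A x ->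
  exists2 s : R, 0 < s & forall y, `|y - x| < s -> A y.
Proof. by rewrite openE => h /h /nbhs_normP. Qed.

Lemma normP_open (A : set V) :
  (forall x, A x -> exists2 s : R, 0 < s & forall y, `|y - x| < s -> A y) -> open A.
Proof. by move=> h; rewrite openE => x /h /nbhs_normP. Qed.

(** The points that can be joined to [x0] with a bound on the oscillation which is
    uniform over all conformal maps form a set open and closed in [U]. *)
Lemma conformal_diam (U X : set V) :
  open U -> connected U -> compact X -> X `<=` U ->
  exists2 M : R, 0 < M & forall (f : V -> V) (L : R), 0 <= L ->
    (forall x, U x -> exists2 c, c <= L & conformal_at f x c) ->
    forall x y, X x -> X y -> `|f x - f y| <= M * L.
Proof.
move=> oU cU cX XU.
have [[x0 Xx0]|X0] := pselect (X !=set0); last first.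
  by exists 1 => // f L _ _ x y Xx; exfalso; apply: X0; exists x.
pose P (M : R) x := forall (f : V -> V) (L : R), 0 <= L ->
    (forall x, U x -> exists2 c, c <= L & conformal_at f x c) ->
    `|f x - f x0| <= M * L.
have D0 : 0 < D by exact: sqrtdim_gt0.
have step x : U x -> exists2 s : R, 0 < s & (forall y, `|y - x| < s ->
    U y /\ (forall M, P M x -> P (M + D * s) y) /\ (forall M, P M y -> P (M + D * s) x)).
  move=> Ux; have [s s0 hs] := open_normP oU Ux; exists s => // y ys.
  have Q f L : 0 <= L ->
      (forall x, U x -> exists2 c, c <= L & conformal_at f x c) ->
      `|f x - f y| <= D * s * L.
    move=> L0 hf.
    have xx : `|x - x| < s by rewrite subrr normr0.
    have := conformal_lip L0 (fun z zs => hf z (hs z zs)) xx ys.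
    move=> /le_trans; apply; rewrite mulrC ler_wpM2r // ler_pM2l //.
    by rewrite distrC ltW.
  split; first exact: hs.
  split=> M PM f L L0 hf; have := PM f L L0 hf; have := Q f L L0 hf.
    rewrite (mulrDl M) distrC => q1 q2; have -> : f y - f x0 = (f y - f x) + (f x - f x0).
      by rewrite addrA subrK.
    by rewrite (le_trans (ler_normD _ _)) // [leRHS]addrC lerD.
  rewrite (mulrDl M) => q1 q2; have -> : f x - f x0 = (f x - f y) + (f y - f x0).
    by rewrite addrA subrK.
  by rewrite (le_trans (ler_normD _ _)) // [leRHS]addrC lerD.
pose A := [set x | U x /\ exists M, P M x].
have AU : A = U.
  apply: cU.
  - exists x0; split; first exact: XU.
    by exists 0 => f L L0 _; rewrite subrr normr0 mul0r.
  - exists A; last by apply/seteqP; split => x; [move=> [h1 h2]|move=> []].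
    apply: normP_open => x [/step[s s0 hs] [M PM]]; exists s => // y /hs[Uy [h _]].
    by split=> //; exists (M + D * s); exact: h.
  - exists (~` (U `&` ~` A)).
      apply: open_closedC; apply: normP_open => x [Ux nAx].
      have [s s0 hs] := step x Ux; exists s => // y /hs[Uy [_ h]]; split=> //.
      by move=> [_ [M PM]]; apply: nAx; split=> //; exists (M + D * s); exact: h.
    apply/seteqP; split => x.
      by move=> Ax; split; [case: Ax|move=> []].
    by move=> [Ux h]; apply: contrapT => nAx; exact: h.
(* Compactness in near-covering form: a constant valid near each point of [X] gives one constant for
   the whole of [X]. *)
have cov : \forall M \near +oo, X `<=` P M.
  move/compact_near_coveringP : cX => /(_ _ (pinfty_nbhs R) P _); apply => x Xx.
  have Ux := XU x Xx.
  have [s s0 hs] := step x Ux.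
  have [_ [M PM]] : A x by rewrite AU.
  exists ([set y | `|y - x| < s], [set N : R | M + D * s < N]) => /=.
    split; first by apply/nbhs_normP; exists s.
    by exists (M + D * s); split; [rewrite num_real|].
  move=> [y N] /= [ys hN] f L L0 hf; have [_ [h _]] := hs y ys.
  apply: le_trans (h M PM f L L0 hf) _.
  by rewrite ler_wpM2r // ltW.
have [M [Mr hM]] := cov.
pose N := Num.max M 0 + 1.
have hN : X `<=` P N by apply: hM; rewrite /N ltr_pwDr // le_max lexx.
have N0 : 0 < N by rewrite /N ltr_wpDl // le_max lexx orbT.
exists (2 * N); first by rewrite mulr_gt0.
move=> f L L0 hf x y Xx Xy.
have -> : f x - f y = (f x - f x0) - (f y - f x0) by rewrite opprB addrA subrK.
have h1 : `|f x - f x0| <= N * L by exact: hN.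
have h2 : `|f y - f x0| <= N * L by exact: hN.
by rewrite (le_trans (ler_normB _ _)) //; lra.
Qed.

(** The parameter [a] bounds both the scales and the ratio of the radii: the condition survives
    shrinking [a], so a single constant can play both parts. *)
Definition corkscrew (X : set V) (a : R) : Prop :=
  forall y (rho : R), X y -> 0 < rho <= a ->
    exists2 z, `|z - y| <= rho & forall z', `|z' - z| < a * rho -> X z'.

(** The homothety of ratio [t] centred at [y] sends the ball around [x0] into [X] by convexity. With
    [t = rho / (2 * B)] the image of [x0] is within [rho] of [y], because |x0 - y| <= 2B. *)
Lemma corkscrew_convex (X : set V) : compact X -> interior X !=set0 ->
  convex_body X -> exists2 a, 0 < a & corkscrew X a.
Proof.
move=> cX [x0 /nbhs_normP[b b0 hb]] cvX.
have [B0 [_ hB0]] := compact_bounded cX.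
pose B := Num.max B0 0 + 1.
have B1 : 1 <= B by rewrite /B lerDr le_max lexx orbT.
have Bpos : 0 < B by rewrite (lt_le_trans ltr01).
have hB y : X y -> `|y| <= B.
  by move=> Xy; apply: (hB0 B) => //; rewrite /B ltr_pwDr // le_max lexx.
have [Xx0 B2] : X x0 /\ 1 <= 2 * B.
  split; first by apply: hb; rewrite subrr normr0.
  by lra.
have B20 : 0 < 2 * B by lra.
pose a := Num.min 1 (b / (2 * B)).
have a0 : 0 < a by rewrite /a lt_min ltr01 divr_gt0.
exists a => // y rho Xy /andP[r0 ra].
pose t := rho / (2 * B).
have t0 : 0 < t by rewrite divr_gt0.
have t1 : t <= 1.
  rewrite /t ler_pdivrMr // mul1r (le_trans _ B2) // (le_trans ra) //.
  by rewrite /a ge_min lexx.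
exists ((1 - t) *: y + t *: x0).
  have -> : (1 - t) *: y + t *: x0 - y = t *: (x0 - y).
    by apply/matrixP => i j; rewrite !mxE; ring.
  rewrite normrZ gtr0_norm // /t mulrAC ler_pdivrMr // ler_pM2l //.
  rewrite (le_trans (ler_normB _ _)) // mulr_natl mulr2n lerD //; exact: hB.
move=> z' hz'.
pose x' := x0 + t^-1 *: (z' - ((1 - t) *: y + t *: x0)).
have -> : z' = (1 - t) *: y + t *: x'.
  rewrite /x' scalerDr scalerA divff ?gt_eqF // scale1r.
  by apply/matrixP => i j; rewrite !mxE; ring.
apply: cvX => //; last by rewrite t1 ltW.
apply: hb; rewrite /x' addrC addKr normrZ gtr0_norm ?invr_gt0 //.
rewrite mulrC ltr_pdivrMr //; apply: (lt_le_trans hz').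
rewrite /t mulrCA -[leLHS]mulrC ler_pM2l //.
by rewrite /a ge_min lexx orbT.
Qed.

End geometry.

Lemma continuous_bigsum {R : realType} (T : topologicalType) (I : Type) (s : seq I)
    (f : I -> T -> R) x :
  (forall i, {for x, continuous (f i)}) ->
  {for x, continuous (fun y => \sum_(i <- s) f i y)}.
Proof.
move=> hf; elim: s => [|i s IH].
  have -> : (fun y => \sum_(i <- [::]) f i y) = cst 0.
    by apply/funext => y; rewrite big_nil.
  exact: cvg_cst.
have -> : (fun y => \sum_(i <- i :: s) f i y) = f i + (fun y => \sum_(i <- s) f i y).
  by apply/funext => y; rewrite big_cons.
by apply: (@cvgD _ _ _ (nbhs x)); [exact: hf|exact: IH].
Qed.

Section smooth_corkscrew.
Context {R : realType} {d : nat}.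
Local Notation V := 'rV[R]_d.
Local Notation D := (@sqrtdim R d).
Implicit Types (u v x y z : V).

Lemma diff_partials (g : V -> R) x u : differentiable g x ->
  'd g x u = \sum_(j < d) u ord0 j * 'D_(delta_mx 0 j) g x.
Proof.
move=> dg; rewrite {1}(row_sum_delta u) linear_sum.
by apply: eq_bigr => j _; rewrite linearZ /= deriveE.
Qed.

Lemma corkscrew_interior (X : set V) p : interior X p ->
  exists s a : R, [/\ 0 < s, 0 < a & forall y, X y -> `|y - p| < s ->
    forall rho, 0 < rho <= a ->
    exists2 z, `|z - y| <= rho & forall z', `|z' - z| < a * rho -> X z'].
Proof.
move=> /nbhs_normP[s s0 hs].
exists (s / 2), (Num.min 1 (s / 2)); split.
- by lra.
- by rewrite lt_min ltr01 /=; lra.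
move=> y Xy ys rho /andP[r0]; set a := Num.min 1 (s / 2) => ra.
have a1 : a <= 1 by rewrite /a ge_min lexx.
have as2 : a <= s / 2 by rewrite /a ge_min lexx orbT.
exists y; first by rewrite subrr normr0 ltW.
move=> z' hz'; apply: hs.
have -> : z' - p = (z' - y) + (y - p) by rewrite addrA subrK.
rewrite (le_lt_trans (ler_normD _ _)) //.
have : a * rho <= 1 * (s / 2) by apply: ler_pM => //; lra.
by lra.
Qed.

(** The signed axis vector [w] points in a direction in which [g] decreases at [p]. The directional
    derivative [F] is jointly continuous, hence negative for base points near [p] and directions
    near [w]. Each point of the small ball is [y + rho *: u] with [u] near [w], and the segment from
    [y] to it keeps [g <= 0]. *)
Lemma corkscrew_boundary (X U : set V) (g : V -> R) (i : 'I_d) p :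
  open U -> U p -> Ck 1 U g -> 'D_(delta_mx 0 i) g p != 0 ->
  X `&` U = [set x | U x /\ g x <= 0] ->
  exists s a : R, [/\ 0 < s, 0 < a & forall y, X y -> `|y - p| < s ->
    forall rho, 0 < rho <= a ->
    exists2 z, `|z - y| <= rho & forall z', `|z' - z| < a * rho -> X z'].
Proof.
move=> oU Up [dg cg] gi XU.
pose w : V := (- Num.sg ('D_(delta_mx 0 i) g p)) *: delta_mx 0 i.
pose F (q : V * V) : R := \sum_(j < d) q.2 ord0 j * 'D_(delta_mx 0 j) g q.1.
have Fpw : F (p, w) < 0.
  rewrite /F (bigD1 i) //= big1 ?addr0; last first.
    by move=> j ji; rewrite !mxE eqxx /= (negbTE ji) mulr0 mul0r.
  by rewrite !mxE !eqxx mulr1 mulNr oppr_lt0 -normrEsg normr_gt0.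
have cF : {for (p, w), continuous F}.
  apply: continuous_bigsum => j.
  apply: (@cvgM _ _ (nbhs (p, w)) _ (fun q : V * V => q.2 ord0 j)
           (fun q : V * V => 'D_(delta_mx 0 j) g q.1)).
    apply: (@continuous_comp _ _ _ (snd : V * V -> V) (fun u : V => u ord0 j)).
      exact: cvg_snd.
    exact: coord_continuous.
  apply: (@continuous_comp _ _ _ (fst : V * V -> V) ('D_(delta_mx 0 j) g)).
    exact: cvg_fst.
  by apply: (cg j).
have [[A B] /= [/nbhs_normP[s1 s10 hA] /nbhs_normP[b b0 hB]] hAB] :
    nbhs (p, w) [set q | F q < 0].
  exact: (cF _ (@lt_nbhsl _ _ _ Fpw)).
have [s2 s20 hU] := open_normP oU Up.
pose s := Num.min s1 s2.
have s0 : 0 < s by rewrite /s lt_min s10.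
have ss1 : s <= s1 by rewrite /s ge_min lexx.
have ss2 : s <= s2 by rewrite /s ge_min lexx orbT.
pose a := Num.min 1 (Num.min b (s / 4)).
have a0 : 0 < a by rewrite /a !lt_min ltr01 b0 /=; lra.
have a1 : a <= 1 by rewrite /a ge_min lexx.
have ab : a <= b by rewrite /a !ge_min lexx orbT.
have as4 : a <= s / 4 by rewrite /a !ge_min lexx !orbT.
exists (s / 2), a; split=> //; first by lra.
move=> y Xy ys rho /andP[r0 ra].
have w1 : `|w| <= 1.
  apply: norm_le_coord => // j; rewrite !mxE eqxx /= normrM normrN normr_sg.
  by case: (_ != 0); case: (_ == _); rewrite ?(normr0, normr1, mul0r, mulr0, mulr1, ler01).
have Uy : U y by apply: hU; lra.
have gy : g y <= 0.
  have : (X `&` U) y by [].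
  by rewrite XU => -[].
exists (y + rho *: w).
  by rewrite addrC addKr normrZ gtr0_norm // ler_piMr // ltW.
move=> z' hz'.
pose u := rho^-1 *: (z' - y).
have uw : `|u - w| < b.
  apply: lt_le_trans ab.
  have -> : u - w = rho^-1 *: (z' - (y + rho *: w)).
    rewrite /u opprD addrA (scalerBr _ (z' - y)) scalerA mulVf ?gt_eqF //.
    by rewrite scale1r.
  by rewrite normrZ gtr0_norm ?invr_gt0 // mulrC ltr_pdivrMr.
have zy : z' - y = rho *: u by rewrite /u scalerA divff ?gt_eqF // scale1r.
have zyn : `|z' - y| <= rho * 2.
  have -> : z' - y = (z' - (y + rho *: w)) + rho *: w.
    by apply/matrixP => k j; rewrite !mxE; ring.
  rewrite (le_trans (ler_normD _ _)) // normrZ gtr0_norm // mulr_natr mulr2n lerD //.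
    by rewrite (le_trans (ltW hz')) // ler_piMl // ltW.
  by rewrite ler_piMr // ltW.
have near t : 0 <= t <= 1 -> `|y + t *: (z' - y) - p| < s.
  move=> /andP[t0 t1].
  have -> : y + t *: (z' - y) - p = (y - p) + t *: (z' - y) by rewrite addrAC.
  rewrite (le_lt_trans (ler_normD _ _)) // normrZ ger0_norm //.
  have : t * `|z' - y| <= 1 * (rho * 2) by apply: ler_pM.
  by lra.
have dgs t (t01 : 0 <= t <= 1) : differentiable g (y + t *: (z' - y)).
  by apply: dg; apply: hU; rewrite (lt_le_trans (near _ t01)).
have Ez : z' = y + (z' - y) by rewrite addrC subrK.
have gz : g z' <= 0.
  suff : g (y + (z' - y)) - g y <= 0 by rewrite -Ez; lra.
  apply: (mvt_seg dgs) => t t01; rewrite [X in 'd g _ X]zy linearZ /= pmulr_rle0 // diff_partials; last exact: dgs.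
  apply: ltW; apply: (hAB (_, u)); split => /=; last exact: hB.
  by apply: hA; rewrite (lt_le_trans (near _ t01)).
have Uz : U z'.
  apply: hU; have := near 1; rewrite scale1r lexx ler01 -Ez => /(_ isT).
  by move=> /lt_le_trans; apply.
have : (X `&` U) z' by rewrite XU.
by case.
Qed.

(** The local constants combine by compactness, taken along the filter of small positive [a]. *)
Lemma corkscrew_smooth (X : set V) : compact X -> smooth_boundary X ->
  exists2 a, 0 < a & corkscrew X a.
Proof.
move=> cX sX.
pose P (a : R) y := X y -> forall rho, 0 < rho <= a ->
    exists2 z, `|z - y| <= rho & forall z', `|z' - z| < a * rho -> X z'.
have cov : \forall a \near (0 : R)^'+, X `<=` P a.
  move/compact_near_coveringP : (cX) => /(_ _ ((0 : R)^'+) P _); apply => p Xp.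
  have [s [a [s0 a0 h]]] : exists s a : R, [/\ 0 < s, 0 < a & forall y, X y -> `|y - p| < s ->
    forall rho, 0 < rho <= a ->
    exists2 z, `|z - y| <= rho & forall z', `|z' - z| < a * rho -> X z'].
    have [ip|nip] := pselect (interior X p); first exact: corkscrew_interior.
    have [U [g [oU Up hC [i gi] XU]]] := sX p (subset_closure Xp) nip.
    exact: (corkscrew_boundary oU Up (hC 1%N) gi XU).
  exists ([set y | `|y - p| < s], [set b : R | 0 < b <= a]) => /=.
    split; first by apply/nbhs_normP; exists s.
    by apply: filterS (filterI (nbhs_right_gt _) (nbhs_right_le a0)) => b [b0 ba] /=; rewrite b0 ba.
  move=> [y b] /= [ys /andP[b0 ba]] Xy rho /andP[r0 rb].
  have [|z zy hz] := h y Xy ys rho; first by rewrite r0 (le_trans rb).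
  exists z => // z' hz'; apply: hz; apply: (lt_le_trans hz').
  by rewrite ler_wpM2r // ltW.
have H : (0 : R)^'+ [set a : R | X `<=` P a /\ 0 < a].
  exact: filterI cov (nbhs_right_gt _).
have [a [hX a0]] := @filter_ex _ _ (at_right_proper_filter 0) _ H.
exists a => // y rho Xy; exact: hX.
Qed.

(** Pigeonhole on a grid of mesh [b * r / 2]: two points of one cell are closer than [b * r]. Each
    coordinate ranges over an interval of length [2 * B * r], that is [4 * B / b] meshes, so the
    number of cells does not depend on [r]. *)
Lemma separated_card (b B : R) : 0 < b -> 0 <= B ->
  exists N : nat, forall (T : eqType) (W : seq T) (p : T -> V) x (r : R), 0 < r ->
    uniq W -> (forall w, w \in W -> `|p w - x| <= B * r) ->
    (forall w w', w \in W -> w' \in W -> w != w' -> b * r <= `|p w - p w'|) ->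
    (size W <= N)%N.
Proof.
move=> b0 B0.
pose m := Num.truncn (4 * B / b).
exists #|{ffun 'I_d -> 'I_m.+1}| => T W p x r r0 uW hx sep.
pose q w (j : 'I_d) : R := ((p w - x) ord0 j + B * r) / (b * r / 2).
have br : 0 < b * r / 2 by rewrite divr_gt0 // mulr_gt0.
have q0 w j : w \in W -> 0 <= q w j.
  move=> wW; rewrite divr_ge0 //; last exact: ltW.
  have := le_trans (coord_le_norm (p w - x) j) (hx w wW).
  by rewrite ler_norml => /andP[h1 h2]; rewrite -lerBlDr sub0r.
have qm w j : w \in W -> (Num.truncn (q w j) <= m)%N.
  move=> wW; apply: le_truncn; rewrite /q ler_pdivrMr //.
  have -> : 4 * B / b * (b * r / 2) = B * r + B * r by field; rewrite gt_eqF.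
  rewrite lerD2r; have := le_trans (coord_le_norm (p w - x) j) (hx w wW).
  by rewrite ler_norml => /andP[].
pose cell w : {ffun 'I_d -> 'I_m.+1} := [ffun j => inord (Num.truncn (q w j))].
have inj : {in W &, injective cell}.
  move=> w w' wW wW' /ffunP E; apply/eqP/negPn/negP => /(sep _ _ wW wW').
  apply/negP; rewrite -ltNge.
  apply: (@le_lt_trans _ _ (b * r / 2)); last by lra.
  apply: norm_le_coord; first exact: ltW.
  move=> j; have := E j; rewrite !ffunE => /(congr1 val).
  rewrite /= !inordK ?ltnS ?qm // => Ej.
  have h1 := truncn_itv (q0 w j wW); have h2 := truncn_itv (q0 w' j wW').
  have : `|q w j - q w' j| <= 1.
    move: h1 h2; rewrite Ej -natr1 => /andP[h1 h1'] /andP[h2 h2'].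
    by rewrite ler_norml; apply/andP; split; lra.
  have -> : q w j - q w' j = (p w - p w') ord0 j / (b * r / 2).
    rewrite /q -mulrBl; congr (_ / _); rewrite !mxE; ring.
  by rewrite normrM [X in _ * X]gtr0_norm ?invr_gt0 // ler_pdivrMr // mul1r.
rewrite -(size_map cell) -(card_uniqP _) ?map_inj_in_uniq //.
exact: max_card.
Qed.

End smooth_corkscrew.

Lemma compL_cat {R : realType} {d : nat} {I : Type} (Phi : nat -> I -> 'rV[R]_d -> 'rV[R]_d) j u v x :
  compL Phi j (u ++ v) x = compL Phi j u (compL Phi (j + size u) v x).
Proof.
elim: u j => [|a u IH] j /=; first by rewrite addn0.
by rewrite IH addSnnS.
Qed.

Lemma conformal_id {R : realType} {d : nat} (x : 'rV[R]_d) : conformal_at id x 1.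
Proof.
have [h1 h2] := is_diff_id x; split => // u.
by rewrite h2 mul1r.
Qed.

Lemma inner_radius {R : realType} {d : nat} (X U : set 'rV[R]_d) :
  compact X -> open U -> X `<=` U ->
  exists2 a : R, 0 < a & forall y z, X y -> `|z - y| < a -> U z.
Proof.
move=> cX oU XU.
pose P (a : R) y := forall z, `|z - y| < a -> U z.
have cov : \forall a \near (0 : R)^'+, X `<=` P a.
  move/compact_near_coveringP : (cX) => /(_ _ ((0 : R)^'+) P _); apply => p Xp.
  have [s s0 hs] := open_normP oU (XU p Xp).
  have s20 : 0 < s / 2 by lra.
  exists ([set y | `|y - p| < s / 2], [set b : R | 0 < b <= s / 2]) => /=.
    split; first by apply/nbhs_normP; exists (s / 2).
    by apply: filterS (filterI (nbhs_right_gt _) (nbhs_right_le s20)) => b [b0 ba] /=; rewrite b0 ba.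
  move=> [y b] /= [ys /andP[b0 bs]] z zy; apply: hs.
  have -> : z - p = (z - y) + (y - p) by rewrite addrA subrK.
  by rewrite (le_lt_trans (ler_normD _ _)) //; lra.
have H : (0 : R)^'+ [set a : R | X `<=` P a /\ 0 < a].
  exact: filterI cov (nbhs_right_gt _).
have [a [hX a0]] := @filter_ex _ _ (at_right_proper_filter 0) _ H.
by exists a => // y z Xy; exact: hX.
Qed.

(** * Distortion, diameters and counting of cylinders *)

Section ncifs.
Context {R : realType} {d : nat} {I : eqType}.
Local Notation V := 'rV[R]_d.
Local Notation D := (@sqrtdim R d).
Variables (i0 : 'I_d) (X Vs : set V) (K eta : R) (Phi : nat -> I -> V -> V).
Hypothesis H : NCIFS X Vs K eta Phi.
Implicit Types (x y z : V) (u v w : seq I).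

(** The distortion hypothesis covers nonempty words only; the empty word, of derivative 1, needs a
    constant at least 1. *)
Local Notation K1 := (Num.max 1 K).

Lemma K1_ge1 : 1 <= K1. Proof. by rewrite le_max lexx. Qed.
Lemma K1_gt0 : 0 < K1. Proof. exact: lt_le_trans K1_ge1. Qed.

Let XV : X `<=` Vs. Proof. by case: H => _ _ [[]]. Qed.
Let oV : open Vs. Proof. by case: H => _ _ [[]]. Qed.

Lemma level_conformal j i x : (0 < j)%N -> Vs x ->
  Vs (Phi j i x) /\ exists c, conformal_at (Phi j i) x c.
Proof.
move=> j0 Vx; case: H => _ _ [_ /(_ j i j0)[[h1 _] _ [h2 _] _ h3]] _ _.
split; first by apply: h1; exists x.
by have [c [c0 hc]] := h3 x Vx; exists c; split=> //; exact: h2.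
Qed.

Lemma compL_Vs j w x : Vs x -> Vs (compL Phi j w x).
Proof. by elim: w j => // a w IH j Vx /=; apply: (level_conformal a _ _).1 => //; exact: IH. Qed.

Lemma compL_X j w x : X x -> X (compL Phi j w x).
Proof.
elim: w j => // a w IH j Xx /=; case: H => h _ _ _ _.
by apply: (h j.+1 a isT); exists (compL Phi j.+1 w x) => //; exact: IH.
Qed.

Lemma compL_conformal_ex j w x : Vs x -> exists c, conformal_at (compL Phi j w) x c.
Proof.
elim: w j => [|a w IH] j Vx /=.
  by exists 1; exact: conformal_id.
have [c hc] := IH j.+1 Vx.
have [_ [c' hc']] := level_conformal a (ltn0Sn j) (compL_Vs j.+1 w Vx).
by exists (c' * c); exact: conformal_comp.
Qed.

Lemma compL_conformal j w x : Vs x ->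
  conformal_at (compL Phi j w) x (dnorm (compL Phi j w) x).
Proof. by move=> /(compL_conformal_ex j w)[c hc]; rewrite (dnorm_conformal i0 hc). Qed.

Lemma dnorm_compL_gt0 j w x : Vs x -> 0 < dnorm (compL Phi j w) x.
Proof. by move=> /(compL_conformal j w)[]. Qed.

Lemma dnorm_compL_cat j u v x : Vs x ->
  dnorm (compL Phi j (u ++ v)) x =
  dnorm (compL Phi j u) (compL Phi (j + size u) v x) * dnorm (compL Phi (j + size u) v) x.
Proof.
move=> Vx; have -> : compL Phi j (u ++ v) = compL Phi j u \o compL Phi (j + size u) v.
  by apply/funext => y; rewrite compL_cat.
apply: (dnorm_conformal i0); apply: conformal_comp; apply: compL_conformal => //.
exact: compL_Vs.
Qed.

Lemma dnorm_compL_nil j x : dnorm (compL Phi j [::]) x = 1.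
Proof.
exact: (dnorm_conformal i0 (conformal_id x)).
Qed.

Lemma dnorm_compL_le j w x : X x -> dnorm (compL Phi j w) x <= eta ^+ size w.
Proof.
move=> Xx; elim: w j => [|a w IH] j; first by rewrite dnorm_compL_nil.
have hE y : dnorm (compL Phi j [:: a]) y = dnorm (Phi j.+1 a) y by [].
rewrite -[a :: w]/([:: a] ++ w) dnorm_compL_cat; last exact: XV.
rewrite addn1 hE /= exprS.
case: H => _ _ _ _ [h _].
have Vx := XV Xx.
apply: ler_pM; [|exact: ltW (dnorm_compL_gt0 _ _ Vx)|apply: h => //; exact: compL_X|exact: IH].
by rewrite -hE ltW // dnorm_compL_gt0 //; apply: compL_Vs.
Qed.

Lemma dnorm_distortion j w x y : Vs x -> Vs y ->
  dnorm (compL Phi j w) x <= K1 * dnorm (compL Phi j w) y.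
Proof.
move=> Vx Vy; case: w => [|a w].
  by rewrite !dnorm_compL_nil mulr1 K1_ge1.
case: H => _ _ _ h _; apply: le_trans (h j (a :: w) x y _ Vx Vy) _ => //.
by rewrite ler_wpM2r ?le_max ?lexx ?orbT // ltW // dnorm_compL_gt0.
Qed.

Local Notation Dn j w := (Dnorm X (compL Phi j w)).

Lemma dnorm_le_Dnorm j w x : X x -> dnorm (compL Phi j w) x <= Dn j w.
Proof.
move=> Xx; apply: ub_le_sup; last by exists x.
by exists (eta ^+ size w) => _ [y Xy <-]; exact: dnorm_compL_le.
Qed.

(** The inverse of each map is continuous on the open image of [Vs], so it pulls [X] back to a
    neighbourhood of the image point. *)
Lemma interior_X_image j w x : interior X x -> interior X (compL Phi j w x).
Proof.
elim: w j => // a w IH j ix /=.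
have iy := IH j.+1 ix; set y := compL Phi j.+1 w x in iy *.
case: (H) => hX _ [_ /(_ j.+1 a isT)[[h1 h1'] _ _ [g [hg [hg' _]]] _]] _ _.
have Vy : Vs y by apply: XV; exact: interior_subset iy.
have cg : {for Phi j.+1 a y, continuous g}.
  by apply: differentiable_continuous; apply: hg'; exists y.
have nX : nbhs (g (Phi j.+1 a y)) X by rewrite hg.
have nI : nbhs (Phi j.+1 a y) (Phi j.+1 a @` Vs).
  by apply: open_nbhs_nbhs; split=> //; exists y.
apply: filterS (filterI nI (cg _ nX)) => _ [[z Vz <-]] /=; rewrite /= hg // => Xz.
by apply: (hX j.+1 a isT); exists z.
Qed.

(** Common leading letters cancel by injectivity on [Vs]; at the first difference the one-level
    disjointness applies, since the inner points are still interior. *)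
Lemma compL_disjoint j w w' x x' : size w = size w' -> w != w' ->
  interior X x -> interior X x' -> compL Phi j w x <> compL Phi j w' x'.
Proof.
elim: w w' j => [|a w IH] [|a' w'] j //= [sw] nw ix ix' E.
have iy := interior_X_image j.+1 w ix; have iy' := interior_X_image j.+1 w' ix'.
have [ea|na] := eqVneq a a'; last first.
  case: (H) => _ /(_ j.+1 a a' isT (elimN eqP na)) h _ _ _.
  have : (Phi j.+1 a @` interior X `&` Phi j.+1 a' @` interior X) (Phi j.+1 a (compL Phi j.+1 w x)).
    by split; [exists (compL Phi j.+1 w x)|rewrite E; exists (compL Phi j.+1 w' x')].
  by rewrite h.
move: nw E; rewrite ea eqseq_cons eqxx /= => nw E.
case: (H) => _ _ [_ /(_ j.+1 a' isT)[_ inj _ _ _]] _ _.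
apply: (IH w' j.+1 sw nw ix ix'); apply: inj => //; apply: XV; exact: interior_subset.
Qed.

Hypothesis Xne : X !=set0.

Lemma Dnorm_gt0 j w : 0 < Dn j w.
Proof.
have [x Xx] := Xne; apply: lt_le_trans (dnorm_le_Dnorm j w Xx).
by apply: dnorm_compL_gt0; exact: XV.
Qed.

Lemma Dnorm_le (f : V -> V) (c : R) : (forall x, X x -> dnorm f x <= c) -> Dnorm X f <= c.
Proof.
move=> h; apply: ge_sup; last by move=> _ [x Xx <-]; exact: h.
by have [x Xx] := Xne; exists (dnorm f x), x.
Qed.

Lemma Dnorm_le_eta j w : Dn j w <= eta ^+ size w.
Proof. by apply: Dnorm_le => x Xx; exact: dnorm_compL_le. Qed.

Lemma Dnorm_le_dnorm j w x : Vs x -> Dn j w <= K1 * dnorm (compL Phi j w) x.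
Proof. by move=> Vx; apply: Dnorm_le => y Xy; apply: dnorm_distortion => //; exact: XV. Qed.

Lemma dnorm_le_K1_Dnorm j w x : Vs x -> dnorm (compL Phi j w) x <= K1 * Dn j w.
Proof.
move=> Vx; have [y Xy] := Xne.
apply: le_trans (dnorm_distortion j w Vx (XV Xy)) _.
by rewrite ler_pM2l ?K1_gt0 // dnorm_le_Dnorm.
Qed.

Lemma Dnorm_nil j : Dn j [::] = 1.
Proof.
apply/eqP; rewrite eq_le; apply/andP; split.
  by apply: Dnorm_le => x _; rewrite dnorm_compL_nil.
by have [x Xx] := Xne; rewrite -(dnorm_compL_nil j x) dnorm_le_Dnorm.
Qed.

Lemma Dnorm_cat_le j u v : Dn j (u ++ v) <= Dn j u * Dn (j + size u) v.
Proof.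
apply: Dnorm_le => x Xx; have Vx := XV Xx; rewrite dnorm_compL_cat //.
apply: ler_pM.
- by apply: ltW; apply: dnorm_compL_gt0; exact: compL_Vs.
- by apply: ltW; exact: dnorm_compL_gt0.
- by apply: dnorm_le_Dnorm; exact: compL_X.
- exact: dnorm_le_Dnorm.
Qed.

(** By distortion the outer derivative at the point reached through [v] is at least
    [Dn j u / K1]. *)
Lemma Dnorm_cat_ge j u v : Dn j u * Dn (j + size u) v <= K1 * Dn j (u ++ v).
Proof.
rewrite mulrC -(ler_pdivlMr _ _ (Dnorm_gt0 j u)).
apply: Dnorm_le => x Xx; have Vx := XV Xx.
rewrite (ler_pdivlMr _ _ (Dnorm_gt0 j u)).
have h1 := dnorm_le_Dnorm j (u ++ v) Xx.
rewrite (dnorm_compL_cat j u v Vx) in h1.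
have h2 := Dnorm_le_dnorm j u (compL_Vs (j + size u) v Vx).
have h3 := dnorm_compL_gt0 (j + size u) v Vx.
have aux (k p q s t : R) : 0 < k -> 0 < s -> q <= k * p -> p * s <= t -> s * q <= k * t.
  move=> k0 s0 hq ht; apply: (@le_trans _ _ (k * (p * s))); last by rewrite ler_pM2l.
  by rewrite mulrA [leRHS]mulrC ler_pM2l.
exact: (aux _ _ _ _ _ K1_gt0 h3 h2 h1).
Qed.

Hypothesis cX : compact X.

Lemma compL_diam : exists2 M : R, 0 < M &
  forall j w x y, X x -> X y -> `|compL Phi j w x - compL Phi j w y| <= M * Dn j w.
Proof.
have cV : connected Vs by case: (H) => _ _ [[]].
have [M M0 hM] := conformal_diam oV cV cX XV.
exists (M * K1); first by rewrite mulr_gt0 // K1_gt0.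
move=> j w x y Xx Xy; rewrite -mulrA; apply: hM => //.
  by rewrite mulr_ge0 // ltW // ?K1_gt0 ?Dnorm_gt0.
move=> z Vz; exists (dnorm (compL Phi j w) z); first exact: dnorm_le_K1_Dnorm.
exact: compL_conformal.
Qed.

(** Each cylinder of size at least [r] that meets the ball of radius [r] around [x]
    contains an inner ball of radius comparable to [r] at distance [O(r)] from [x]. *)
Lemma cylinder_count (a : R) : 0 < a -> corkscrew X a ->
  exists N : nat, forall j n x (r : R) (W : seq (seq I)), 0 < r -> uniq W ->
    (forall w, w \in W -> [/\ size w = n, r <= Dn j w &
       exists2 y, X y & `|compL Phi j w y - x| <= r]) ->
    (size W <= N)%N.
Proof.
move=> a0 ha.
have [rho0 rho00 hrho] := inner_radius cX oV XV.
(* Radii up to [b] are within the scales of the corkscrew condition and small enough to stay in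
   [Vs]. *)
pose b := Num.min a (rho0 / 2).
have b0 : 0 < b by rewrite /b lt_min a0 /=; lra.
have ba : b <= a by rewrite /b ge_min lexx.
have brho : b < rho0 by rewrite /b gt_min; apply/orP; right; lra.
have D0 : 0 < D by exact: sqrtdim_gt0.
have K0 := K1_gt0.
(* The separation comes from [conformal_ball_image] on half a corkscrew ball:
   [Dn j w / K1 / (2 * D)] times the radius [a * rho w / 2] equals this constant times [r]. *)
have sep0 : 0 < a * b / (4 * K1 * D) by rewrite divr_gt0 // !mulr_gt0.
have B0 : 0 <= K1 * D * b + 1 by rewrite addr_ge0 // ltW // !mulr_gt0.
have [N hN] := @separated_card R d _ _ sep0 B0.
exists N => j n x r W r0 uW hW.
(* The scale at which the map of [w] produces sets of size comparable to [r]; [r <= Dn j w] keeps it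
   below [b]. *)
pose rho w := b * r / Dn j w.
have rho_gt0 w : 0 < rho w by rewrite /rho divr_gt0 ?mulr_gt0 ?Dnorm_gt0.
have rho_le w : w \in W -> rho w <= b.
  by move=> /hW[_ rD _]; rewrite /rho -mulrA; apply: ler_piMr (ltW b0) _; rewrite (ler_pdivrMr _ _ (Dnorm_gt0 j w)) mul1r.
have /choice[z hz] : forall w, exists z, w \in W ->
    `|compL Phi j w z - x| <= (K1 * D * b + 1) * r /\
    (forall z', `|z' - z| < a * rho w -> X z').
  move=> w; have [wW|] := boolP (w \in W); last by exists x.
  have [sw rD [y Xy yx]] := hW w wW.
  have [|z zy hz] := ha y (rho w) Xy; first by rewrite rho_gt0 (le_trans (rho_le w wW)).
  exists z => _; split=> //.
  have -> : compL Phi j w z - x = (compL Phi j w z - compL Phi j w y) + (compL Phi j w y - x).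
    by rewrite addrA subrK.
  rewrite (le_trans (ler_normD _ _)) // mulrDl mul1r lerD //.
  have L0 : 0 <= K1 * Dn j w by rewrite mulr_ge0 // ltW // Dnorm_gt0.
  have hc y' : `|y' - y| < rho0 -> exists2 c, c <= K1 * Dn j w & conformal_at (compL Phi j w) y' c.
    move=> y'y; have Vy' := hrho _ _ Xy y'y.
    by exists (dnorm (compL Phi j w) y'); [exact: dnorm_le_K1_Dnorm|exact: compL_conformal].
  have zr : `|z - y| < rho0 by rewrite (le_lt_trans zy) // (le_lt_trans (rho_le w wW)).
  have yr : `|y - y| < rho0 by rewrite subrr normr0.
  apply: le_trans (conformal_lip L0 hc zr yr) _.
  rewrite (@le_trans _ _ (K1 * Dn j w * (D * rho w))) // ?ler_pM2l ?mulr_gt0 ?Dnorm_gt0 //.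
  rewrite le_eqVlt; apply/orP; left; apply/eqP; rewrite /rho; field.
  by rewrite gt_eqF // Dnorm_gt0.
have zint w x' : w \in W -> `|x' - z w| < a * rho w -> interior X x'.
  move=> wW x'z; have [_ hzw] := hz w wW.
  apply/nbhs_normP; exists (a * rho w - `|x' - z w|); first by rewrite subr_gt0.
  move=> y yx'; apply: hzw; have -> : y - z w = (y - x') + (x' - z w) by rewrite addrA subrK.
  by rewrite (le_lt_trans (ler_normD _ _)) //; lra.
apply: (hN _ W (fun w => compL Phi j w (z w)) x r r0 uW) => [w wW|w w' wW wW' nw].
  exact: (hz w wW).1.
(* If two image centres were too close, the image of the half ball around [z w] would contain the
   image of [z w'], against the disjointness of the interiors. Half the radius keeps the closed ball
   inside the corkscrew ball. *)
rewrite leNgt; apply/negP => hlt.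
have half : a * rho w / 2 < a * rho w.
  by have : 0 < a * rho w by [rewrite mulr_gt0]; lra.
have s0 : 0 < a * rho w / 2 by rewrite divr_gt0 // mulr_gt0.
have c0 : 0 < Dn j w / K1 by rewrite divr_gt0 // Dnorm_gt0.
have [|| x' x'z E] := @conformal_ball_image R d (compL Phi j w) (z w) _ _
    (compL Phi j w' (z w')) s0 c0.
- move=> y yz; have iy : interior X y.
    by apply: (zint w) => //; apply: (le_lt_trans yz); exact: half.
  have Vy : Vs y by apply: XV; exact: interior_subset iy.
  exists (dnorm (compL Phi j w) y); last exact: compL_conformal.
  by rewrite ler_pdivrMr // mulrC Dnorm_le_dnorm.
- apply: (lt_le_trans hlt); rewrite le_eqVlt; apply/orP; left; apply/eqP; rewrite /rho; field.
  by rewrite !gt_eqF // Dnorm_gt0.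
have [sw _ _] := hW w wW; have [sw' _ _] := hW w' wW'.
apply: (@compL_disjoint j w w' x' (z w') _ nw _ _ E); first by rewrite sw.
  by apply: (zint w _ wW); apply: (lt_trans x'z); exact: half.
apply: (zint w' _ wW'); rewrite subrr normr0; exact: mulr_gt0 a0 (rho_gt0 w').
Qed.

End ncifs.

(** * Level sums of quasi-multiplicative weights *)

Section words.
Context {I : eqType}.
Implicit Types (F : seq I) (u v w : seq I).

Fixpoint words F n : seq (seq I) :=
  if n is n'.+1 then [seq a :: w | a <- F, w <- words F n'] else [:: [::]].

Lemma mem_words F n w : (w \in words F n) = (size w == n) && all (mem F) w.
Proof.
elim: n w => [|n IH] [|a w] //=.
  by apply/negP => /allpairsP[[b w']] [].
apply/allpairsP/idP => [[[b w']] /= [bF]|/andP[]].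
  by rewrite IH => /andP[/eqP <- h] [-> ->] /=; rewrite bF h eqxx.
rewrite eqSS => sw /andP[aF wF]; exists (a, w) => /=; split => //.
by rewrite IH sw wF.
Qed.

Lemma words_uniq F n : uniq F -> uniq (words F n).
Proof.
move=> uF; elim: n => //= n IH; apply: allpairs_uniq => //.
by move=> [a w] [b w'] _ _ /= [-> ->].
Qed.

Lemma big_words_cons {R : nmodType} F n (f : seq I -> R) :
  \sum_(w <- words F n.+1) f w = \sum_(a <- F) \sum_(w <- words F n) f (a :: w).
Proof. exact: big_allpairs_dep. Qed.

Lemma big_words_cat {R : nmodType} F k m (f : seq I -> R) :
  \sum_(w <- words F (k + m)) f w =
  \sum_(u <- words F k) \sum_(v <- words F m) f (u ++ v).
Proof.
elim: k f => [|k IH] f; first by rewrite big_seq1.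
rewrite addSn !big_words_cons; apply: eq_bigr => a _.
by rewrite (IH (fun w => f (a :: w))).
Qed.

Lemma big_words1 {R : nmodType} F (f : seq I -> R) :
  \sum_(w <- words F 1) f w = \sum_(a <- F) f [:: a].
Proof. by rewrite big_words_cons; apply: eq_bigr => a _; rewrite big_seq1. Qed.

End words.

Section weights.
Context {R : realType} {I : eqType}.
Variables (D : nat -> seq I -> R) (K : R).
Implicit Types (F : seq I) (u v w : seq I) (t : R).

(** The axioms satisfied by the norms [D j w] of the derivatives of the compositions
    of the maps of consecutive levels [j+1, ..., j + size w]. *)
Definition quasi_mult : Prop :=
  [/\ 1 <= K, (forall j w, 0 < D j w), (forall j, D j [::] = 1),
      (forall j u v, D j (u ++ v) <= D j u * D (j + size u) v) &
      (forall j u v, D j u * D (j + size u) v <= K * D j (u ++ v))].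

Hypothesis HD : quasi_mult.

Definition psum F j n t : R := \sum_(w <- words F n) D j w `^ t.

Let D_gt0 j w : 0 < D j w. Proof. by case: HD. Qed.
Let D_ge0 j w : 0 <= D j w. Proof. exact: ltW. Qed.
Let K_gt0 : 0 < K. Proof. by case: HD => h _ _ _ _; exact: lt_le_trans h. Qed.

Lemma psum_ge0 F j n t : 0 <= psum F j n t.
Proof. by apply: sumr_ge0 => w _; exact: powR_ge0. Qed.

Lemma psum_gt0 F j n t : F != [::] -> 0 < psum F j n t.
Proof.
case: F => // a F _; rewrite /psum.
have aw : nseq n a \in words (a :: F) n.
  by rewrite mem_words size_nseq eqxx /=; apply/allP => b /nseqP[-> _]; exact: mem_head.
rewrite (big_rem _ aw) /=; apply: ltr_pwDl; first exact: powR_gt0.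
by apply: sumr_ge0 => w _; exact: powR_ge0.
Qed.

Lemma D_cat_powR_le j u v t : 0 <= t ->
  D j (u ++ v) `^ t <= D j u `^ t * D (j + size u) v `^ t.
Proof.
case: HD => _ _ _ h _ t0; rewrite -powRM //.
by apply: ge0_ler_powR => //; rewrite nnegrE // mulr_ge0.
Qed.

Lemma D_cat_powR_ge j u v t : 0 <= t ->
  D j u `^ t * D (j + size u) v `^ t <= K `^ t * D j (u ++ v) `^ t.
Proof.
case: HD => _ _ _ _ h t0; rewrite -!powRM //; last exact: ltW.
by apply: ge0_ler_powR => //; rewrite nnegrE // mulr_ge0 // ltW.
Qed.

Lemma psum_prefix_le F j u m t : 0 <= t ->
  \sum_(v <- words F m) D j (u ++ v) `^ t <= D j u `^ t * psum F (j + size u) m t.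
Proof.
by move=> t0; rewrite /psum mulr_sumr; apply: ler_sum => v _; exact: D_cat_powR_le.
Qed.

Lemma psum_cat_ge F j k m t : 0 <= t ->
  psum F j k t * psum F (j + k) m t <= K `^ t * psum F j (k + m) t.
Proof.
move=> t0; rewrite [psum F j (k + m) t]/psum big_words_cat [leRHS]mulr_sumr.
rewrite [psum F j k t]/psum mulr_suml.
rewrite big_seq [leRHS]big_seq; apply: ler_sum => u.
rewrite mem_words => /andP[/eqP <- _].
by rewrite [leLHS]mulr_sumr [leRHS]mulr_sumr; apply: ler_sum => v _; exact: D_cat_powR_ge.
Qed.

Section ball.
Variables (F : seq I) (t r eta g C0 : R) (N : nat) (Q : pred (seq I)).
Hypothesis t0 : 0 < t.
Hypothesis r01 : 0 < r < 1.
Hypothesis Qpre : forall u v, Q (u ++ v) -> Q u.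
Hypothesis QN : forall k, (size [seq u <- words F k | ((r < D 0 u)%R && Q u)%B] <= N)%N.
Hypothesis g1 : 1 < g.
Hypothesis C00 : 0 < C0.
Hypothesis hg : forall k, C0 * g ^+ k <= psum F 0 k t.
Hypothesis Deta : forall w, D 0 w <= eta ^+ size w.

(** The mass of the words of [Q] not yet stopped after [k] letters: all of it for [k = 0], none of
    it once [eta ^+ k <= r]. *)
Let T k m := \sum_(u <- words F k | (r < D 0 u) && Q u)
             \sum_(v <- words F m | Q (u ++ v)) D 0 (u ++ v) `^ t.

Let A := N%:R * (size F)%:R * r `^ t * K `^ t / C0.

(** Splitting off the next letter [a]: either [D (u a) > r] and the word is counted at the
    next stage, or [D (u a) <= r] and its descendants have total mass at most
    [r^t Z_(k+1, m)], for at most [N * size F] words [u a]. *)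
Lemma stopping_step k m : T k m.+1 <= T k.+1 m + A * psum F 0 (k + m.+1) t * (g^-1) ^+ k.+1.
Proof.
have tn : 0 <= t by exact: ltW.
pose S := r `^ t * psum F k.+1 m t.
have S0 : 0 <= S by rewrite mulr_ge0 ?powR_ge0 ?psum_ge0.
pose G w := if (r < D 0 w) && Q w then \sum_(v <- words F m | Q (w ++ v)) D 0 (w ++ v) `^ t else 0.
have G0 w : 0 <= G w.
  by rewrite /G; case: ifP => // _; apply: sumr_ge0 => v _; exact: powR_ge0.
have TG : T k.+1 m = \sum_(u <- words F k) \sum_(a <- F) G (u ++ [:: a]).
  rewrite /T big_mkcond -(addn1 k).
  rewrite (big_words_cat F k 1 (fun w => if (r < D 0 w) && Q w then
     \sum_(v <- words F m | Q (w ++ v)) D 0 (w ++ v) `^ t else 0)).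
  by apply: eq_bigr => u _; rewrite big_words1.
have key u a : size u = k ->
    \sum_(v <- words F m | Q (u ++ a :: v)) D 0 (u ++ a :: v) `^ t <= G (u ++ [:: a]) + S.
  move=> su; have E v : u ++ a :: v = (u ++ [:: a]) ++ v by rewrite -catA.
  have E1 : \sum_(v <- words F m | Q (u ++ a :: v)) D 0 (u ++ a :: v) `^ t =
      \sum_(v <- words F m | Q ((u ++ [:: a]) ++ v)) D 0 ((u ++ [:: a]) ++ v) `^ t.
    by apply: eq_big => v; rewrite E.
  rewrite E1 /G; set w := u ++ [:: a].
  have sw : size w = k.+1 by rewrite size_cat su addn1.
  have [rw|wr] := ltrP r (D 0 w) => /=.
    have [Qw|nQw] := boolP (Q w); first by rewrite lerDl.
    rewrite big1 ?add0r // => v /Qpre.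
    by rewrite (negbTE nQw).
  rewrite add0r big_mkcond /=.
  apply: (@le_trans _ _ (\sum_(v <- words F m) D 0 (w ++ v) `^ t)).
    by apply: ler_sum => v _; case: ifP => // _; exact: powR_ge0.
  apply: (le_trans (psum_prefix_le F 0 w m tn)); rewrite add0n sw ler_wpM2r ?psum_ge0 //.
  by apply: ge0_ler_powR => //; rewrite nnegrE // ltW //; case/andP: r01.
have step1 : T k m.+1 <= \sum_(u <- words F k | (r < D 0 u) && Q u) \sum_(a <- F) (G (u ++ [:: a]) + S).
  rewrite /T big_seq_cond [leRHS]big_seq_cond; apply: ler_sum => u /andP[uk _].
  move: uk; rewrite mem_words => /andP[/eqP su _].
  rewrite big_mkcond big_words_cons; apply: ler_sum => a _.
  by rewrite -big_mkcond; exact: key.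
apply: (le_trans step1).
rewrite (eq_bigr (fun u => \sum_(a <- F) G (u ++ [:: a]) + (size F)%:R * S)); last first.
  by move=> u _; rewrite big_split /= big_const_seq count_predT iter_addr_0 mulr_natl.
rewrite big_split /=; apply: lerD.
  rewrite TG big_mkcond /=; apply: ler_sum => u _; case: ifP => // _.
  by apply: sumr_ge0.
rewrite big_const_seq iter_addr_0 -[leLHS]mulr_natl -size_filter.
have Fg : 0 < g ^+ k.+1 by rewrite exprn_gt0 // (lt_trans ltr01).
apply: (@le_trans _ _ (N%:R * ((size F)%:R * S))).
  by apply: ler_wpM2r; [rewrite mulr_ge0|rewrite ler_nat; exact: QN].
have h1 := psum_cat_ge F 0 k.+1 m tn; rewrite add0n addSnnS in h1.
have h2 : C0 * g ^+ k.+1 * psum F k.+1 m t <= K `^ t * psum F 0 (k + m.+1) t.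
  by apply: le_trans h1; rewrite ler_wpM2r ?psum_ge0.
have h3 : psum F k.+1 m t <= K `^ t * psum F 0 (k + m.+1) t / C0 * (g^-1) ^+ k.+1.
  rewrite exprVn ler_pdivlMr // ler_pdivlMr // (le_trans _ h2) //.
  by rewrite le_eqVlt; apply/orP; left; apply/eqP; ring.
rewrite /A /S; apply: (@le_trans _ _ (N%:R * ((size F)%:R *
   (r `^ t * (K `^ t * psum F 0 (k + m.+1) t / C0 * (g^-1) ^+ k.+1))))).
  by rewrite !ler_wpM2l ?powR_ge0.
by rewrite le_eqVlt; apply/orP; left; apply/eqP; ring.
Qed.

Lemma geo_bound k : \sum_(i < k) (g^-1) ^+ i.+1 <= (g - 1)^-1.
Proof.
have gg : 0 < g - 1 by rewrite subr_gt0.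
have g0 : 0 < g by rewrite (lt_trans ltr01).
suff -> : \sum_(i < k) (g^-1) ^+ i.+1 = (1 - (g^-1) ^+ k) / (g - 1).
  rewrite -[leRHS]mul1r; apply: ler_wpM2r; first by rewrite invr_ge0 ltW.
  by rewrite gerBl exprn_ge0 // invr_ge0 ltW.
elim: k => [|k IH]; first by rewrite big_ord0 expr0 subrr mul0r.
rewrite big_ord_recr /= IH !exprS; field.
by rewrite !gt_eqF.
Qed.

(** Iterating [stopping_step] exhausts the unstopped mass, because [D] is at most [eta ^+ n <= r] on
    words of length [n]. The mass stopped on the way is summed by a geometric series of ratio
    1/g. *)
Lemma ball_mass n : eta ^+ n <= r ->
  \sum_(w <- words F n | Q w) D 0 w `^ t <=
    N%:R * (size F)%:R * K `^ t / C0 / (g - 1) * r `^ t * psum F 0 n t.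
Proof.
move=> etar.
have main k : (k <= n)%N ->
    T 0 n <= T k (n - k) + A * psum F 0 n t * \sum_(i < k) (g^-1) ^+ i.+1.
  elim: k => [|k IH] kn; first by rewrite subn0 big_ord0 mulr0 addr0.
  apply: (le_trans (IH (ltnW kn))).
  have -> : (n - k = (n - k.+1).+1)%N by rewrite subnSK.
  have := stopping_step k (n - k.+1).
  have -> : (k + (n - k.+1).+1 = n)%N by rewrite -addSnnS subnKC.
  by rewrite big_ord_recr /= (mulrDr (A * psum F 0 n t)); lra.
have Tn : T n 0 = 0.
  rewrite /T big_seq_cond big1 // => u /andP[]; rewrite mem_words => /andP[/eqP su _].
  by move=> /andP[+ _]; rewrite ltNge (le_trans (Deta u)) // su.
have T0 : T 0 n = \sum_(w <- words F n | Q w) D 0 w `^ t.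
  rewrite /T /= big_cons big_nil /=; case: HD => _ _ -> _ _.
  have -> : r < 1 by case/andP: r01.
  rewrite addr0 /=; have [//|nQ] := boolP (Q [::]).
  by rewrite big1 // => w Qw; exfalso; move: nQ; rewrite (@Qpre [::] w).
rewrite -T0; apply: (le_trans (main n (leqnn n))).
rewrite subnn Tn add0r.
have A0 : 0 <= A.
  by rewrite /A !mulr_ge0 ?powR_ge0 ?ler0n // invr_ge0 ltW.
apply: (@le_trans _ _ (A * psum F 0 n t * (g - 1)^-1)).
  by rewrite ler_wpM2l ?geo_bound // mulr_ge0 ?psum_ge0.
by rewrite /A le_eqVlt; apply/orP; left; apply/eqP; ring.
Qed.

End ball.
End weights.

(** * Growth of the level sums and finite subsystems *)

Section growth.
Context {R : realType} {I : eqType}.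
Implicit Types (D : nat -> seq I -> R) (F G : seq I) (u v w : seq I).

(** Stands for a bound on the possibly infinite sum over all words of length [n]: finitely many
    words use finitely many letters. *)
Definition psum_bounded D j n (t y : R) : Prop :=
  forall F, uniq F -> psum D F j n t <= y.

(** [growth_le D t c] says that the lower pressure at [t] is at most [c]. *)
Definition growth_le D (t c : R) : Prop :=
  forall (del : R) N, 0 < del ->
    exists n, [/\ (N <= n)%N, (0 < n)%N & psum_bounded D 0 n t (expR ((c + del) * n%:R))].

Lemma psum_mono D F G j n t : uniq F -> uniq G -> {subset F <= G} ->
  psum D F j n t <= psum D G j n t.
Proof.
move=> uF uG FG; rewrite /psum.
have sub : {subset words F n <= words G n}.
  move=> w; rewrite !mem_words => /andP[-> /allP h] /=.
  by apply/allP => a /h; exact: FG.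
rewrite [leRHS](bigID (mem (words F n))) /= -[leLHS]addr0; apply: lerD; last first.
  by apply: sumr_ge0 => w _; exact: powR_ge0.
rewrite -[leRHS]big_filter le_eqVlt; apply/orP; left; apply/eqP; apply: perm_big.
apply: uniq_perm; [exact: words_uniq|by rewrite filter_uniq // words_uniq|].
move=> w; rewrite mem_filter /=; apply/idP/andP => [wF|[]//].
by split => //; exact: sub.
Qed.

Lemma psum_nth_ge D F j n t w : w \in words F n -> D j w `^ t <= psum D F j n t.
Proof.
move=> wF; rewrite /psum (big_rem w) //= lerDl.
by apply: sumr_ge0 => v _; exact: powR_ge0.
Qed.

Lemma pow_unbounded (g B : R) : 1 < g -> exists N, forall n, (N <= n)%N -> B <= g ^+ n.
Proof.
move=> g1; have g10 : 0 < g - 1 by rewrite subr_gt0.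
exists (Num.bound (`|B| / (g - 1))) => n Nn.
have h1 : `|B| / (g - 1) < n%:R.
  apply: (lt_le_trans (archi_boundP _)); first by rewrite divr_ge0 // ltW.
  by rewrite ler_nat.
move: h1; rewrite ltr_pdivrMr // => h1.
have h2 : forall k, k%:R * (g - 1) <= g ^+ k.
  elim=> [|k IH]; first by rewrite mul0r expr0.
  rewrite exprS; have : 1 <= g ^+ k by rewrite exprn_ege1 // ltW.
  have : (g - 1) * 1 <= (g - 1) * g ^+ k by rewrite ler_pM2l // exprn_ege1 // ltW.
  by rewrite -natr1; lra.
by rewrite (le_trans (ler_norm _)) // (le_trans (ltW h1)).
Qed.

Section one.
Variables (D : nat -> seq I -> R) (K : R).
Hypothesis HD : quasi_mult D K.

Let D_gt0 j w : 0 < D j w. Proof. by case: HD. Qed.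
Let K_ge1 : 1 <= K. Proof. by case: HD. Qed.
Let K_gt0 : 0 < K. Proof. exact: lt_le_trans K_ge1. Qed.

Lemma psum_growth_const F t g N : F != [::] -> 1 < g ->
  (forall n, (N <= n)%N -> g ^+ n <= psum D F 0 n t) ->
  exists2 C0, 0 < C0 & forall n, C0 * g ^+ n <= psum D F 0 n t.
Proof.
move=> F0 g1 hg; have g0 : 0 < g by rewrite (lt_trans ltr01).
have [C [C0 C1 hC]] : exists C, [/\ 0 < C, C <= 1 & forall n, (n < N)%N -> C * g ^+ n <= psum D F 0 n t].
  elim: N {hg} => [|N [C [C0 C1 IH]]]; first by exists 1; rewrite ltr01 lexx.
  have Z0 := psum_gt0 HD 0 N t F0.
  exists (Num.min C (psum D F 0 N t / g ^+ N)); split.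
  - by rewrite lt_min C0 divr_gt0 // exprn_gt0.
  - by rewrite ge_min C1.
  - move=> n; rewrite ltnS leq_eqVlt => /orP[/eqP ->|nN].
      by rewrite -ler_pdivlMr ?exprn_gt0 // ge_min lexx orbT.
    apply: le_trans (IH n nN); rewrite ler_wpM2r ?exprn_ge0 ?(ltW g0) //.
    by rewrite ge_min lexx.
exists C => // n; have [nN|Nn] := ltnP n N; first exact: hC.
by apply: le_trans (hg n Nn); rewrite ler_piMl ?exprn_ge0 // ltW.
Qed.

Section approx.
Variables (a : I -> R) (C t : R).
Hypothesis a0 : forall i, 0 < a i.
Hypothesis aD : forall j i, a i <= D j [:: i] <= C * a i.
Hypothesis t0 : 0 <= t.

Let sig F := \sum_(i <- F) a i `^ t.

Let C_ge0 (i : I) : 0 <= C.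
Proof.
have /andP[h1 h2] := aD 0 i; have h3 := le_trans (ltW (D_gt0 0 [:: i])) h2.
by rewrite -(pmulr_lge0 _ (a0 i)).
Qed.

Lemma sig_le_psum F j : sig F <= psum D F j 1 t.
Proof.
rewrite /psum big_words1; apply: ler_sum => i _.
by apply: ge0_ler_powR => //; rewrite ?nnegrE ?(ltW (a0 i)) ?(ltW (D_gt0 _ _)) //; case/andP: (aD j i).
Qed.

Lemma psum_le_sig F j : psum D F j 1 t <= C `^ t * sig F.
Proof.
rewrite /psum big_words1 mulr_sumr; apply: ler_sum => i _.
rewrite -powRM ?(C_ge0 i) ?(ltW (a0 i)) //.
apply: ge0_ler_powR => //; rewrite ?nnegrE ?(ltW (D_gt0 _ _)) //; last by case/andP: (aD j i).
by rewrite mulr_ge0 ?(C_ge0 i) // ltW.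
Qed.

(** Appending one letter multiplies the level sum by at least [sig F / K ^ t], which is at least
    2. *)
Lemma psum_growth_unbounded F : 2 * K `^ t <= sig F ->
  forall n, 2 ^+ n <= psum D F 0 n t.
Proof.
move=> h; elim=> [|n IH].
  by rewrite /psum big_seq1; case: HD => _ _ -> _ _; rewrite powR1 expr0.
have := psum_cat_ge HD F 0 n 1 t0; rewrite add0n addn1 => h1.
rewrite -(ler_pM2l (powR_gt0 t K_gt0)); apply: le_trans h1.
rewrite exprS mulrA [K `^ t * 2]mulrC [leLHS]mulrC; apply: ler_pM.
- by rewrite exprn_ge0.
- by rewrite mulr_ge0 // powR_ge0.
- exact: IH.
- exact: le_trans h (sig_le_psum F n).
Qed.

(** Prefix by prefix: replacing one letter of [F] by a letter of [F0] loses at most a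
    proportion [e] of the mass, by bounded distortion and the comparison with [a]. *)
Lemma psum_restrict F0 F (e : R) : uniq F0 -> uniq F -> {subset F0 <= F} ->
  0 <= e <= 1 ->
  C `^ t * K `^ t * K `^ t * (sig F - sig F0) <= e * sig F ->
  forall n u, (1 - e) ^+ n * (\sum_(v <- words F n) D 0 (u ++ v) `^ t) <=
    \sum_(v <- words F0 n) D 0 (u ++ v) `^ t.
Proof.
move=> uF0 uF F0F /andP[e0 e1] he; have e10 : 0 <= 1 - e by rewrite subr_ge0.
elim=> [|n IH] u; first by rewrite expr0 mul1r.
rewrite !big_words_cons.
pose W i := \sum_(v <- words F n) D 0 (u ++ i :: v) `^ t.
have W0 i : 0 <= W i by apply: sumr_ge0 => v _; exact: powR_ge0.
apply: (@le_trans _ _ ((1 - e) ^+ n * \sum_(i <- F0) W i)); last first.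
  rewrite mulr_sumr; apply: ler_sum => i _.
  have := IH (u ++ [:: i]); rewrite (eq_bigr (fun v => D 0 (u ++ i :: v) `^ t)); last first.
    by move=> v _; rewrite -catA.
  by move=> /le_trans; apply; apply: ler_sum => v _; rewrite -catA.
rewrite exprSr -mulrA ler_wpM2l ?exprn_ge0 //.
pose Z := psum D F (size u).+1 n t.
have Z0 : 0 <= Z by exact: psum_ge0.
(* [B] does not depend on the letter, and [W i] is comparable to [a i ^ t * B]; hence the share of
   the letters outside [F0] can be read off from the weights [a]. *)
pose B := D 0 u `^ t * Z.
have B0 : 0 <= B by rewrite mulr_ge0 ?powR_ge0.
have Wup i : W i <= C `^ t * a i `^ t * B.
  have := psum_prefix_le HD F 0 (u ++ [:: i]) n t0.
  rewrite size_cat add0n addn1 /= => h.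
  have -> : W i = \sum_(v <- words F n) D 0 ((u ++ [:: i]) ++ v) `^ t.
    by apply: eq_bigr => v _; rewrite -catA.
  apply: (le_trans h); rewrite /B mulrA ler_wpM2r //.
  apply: (le_trans (D_cat_powR_le HD 0 u [:: i] t0)); rewrite mulrC ler_wpM2r ?powR_ge0 //.
  rewrite -powRM ?(C_ge0 i) ?(ltW (a0 i)) //.
  apply: ge0_ler_powR => //; rewrite ?nnegrE ?(ltW (D_gt0 _ _)) //.
    by rewrite mulr_ge0 ?(C_ge0 i) // ltW.
  by case/andP: (aD (0 + size u) i).
have Wlo i : a i `^ t * B <= K `^ t * K `^ t * W i.
  have h1 v : D 0 u `^ t * D (size u) [:: i] `^ t * D (size u).+1 v `^ t <=
      K `^ t * K `^ t * D 0 (u ++ i :: v) `^ t.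
    have q1 := D_cat_powR_ge HD 0 u (i :: v) t0.
    have q2 := D_cat_powR_ge HD (size u) [:: i] v t0.
    rewrite add0n /= addn1 in q1 q2.
    rewrite -mulrA (le_trans (ler_wpM2l (powR_ge0 _ _) q2)) //.
    by rewrite mulrCA -mulrA ler_wpM2l ?powR_ge0.
  rewrite /B /Z /psum /W mulrA mulr_sumr mulr_sumr; apply: ler_sum => v _.
  apply: le_trans (h1 v); rewrite ler_wpM2r ?powR_ge0 // mulrC ler_wpM2l ?powR_ge0 //.
  by apply: ge0_ler_powR => //; rewrite ?nnegrE ?(ltW (a0 i)) ?(ltW (D_gt0 _ _)) //; case/andP: (aD (size u) i).
have split (f : I -> R) : \sum_(i <- F) f i = \sum_(i <- F0) f i + \sum_(i <- F | i \notin F0) f i.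
  rewrite (bigID (mem F0)) /=; congr (_ + _).
  rewrite -big_filter; apply: perm_big; apply: uniq_perm => //; first by rewrite filter_uniq.
  by move=> i; rewrite mem_filter /=; apply/andP/idP => [[]//|iF0]; split=> //; exact: F0F.
have rest : \sum_(i <- F | i \notin F0) W i <= e * \sum_(i <- F) W i.
  have KK : 0 < K `^ t * K `^ t by rewrite mulr_gt0 // powR_gt0.
  rewrite -(ler_pM2l KK).
  apply: (@le_trans _ _ (K `^ t * K `^ t * (C `^ t * (\sum_(i <- F | i \notin F0) a i `^ t) * B))).
    rewrite ler_pM2l // mulr_sumr mulr_suml; apply: ler_sum => i _; exact: Wup.
  have -> : \sum_(i <- F | i \notin F0) a i `^ t = sig F - sig F0.
    by rewrite /sig split addrAC subrr add0r.
  apply: (@le_trans _ _ (e * sig F * B)).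
    rewrite mulrA ler_wpM2r // (le_trans _ he) // le_eqVlt; apply/orP; left; apply/eqP; ring.
  rewrite [leRHS]mulrCA -[leLHS]mulrA; apply: ler_wpM2l => //.
  rewrite /sig mulr_suml mulr_sumr; apply: ler_sum => i _; exact: Wlo.
have := split W; lra.
Qed.

Lemma infinite_growth : inhabited I -> ~ growth_le D t 0 ->
  exists F g C0, [/\ uniq F, 1 < g, 0 < C0 & forall n, C0 * g ^+ n <= psum D F 0 n t].
Proof.
move=> [i1] nG.
have [unb|bnd] := pselect (forall B : R, exists2 F, uniq F & B <= sig F).
  have [F uF hF] := unb (2 * K `^ t).
  exists F, 2, 1; split=> //; first by rewrite ltr1n.
  by move=> n; rewrite mul1r; exact: psum_growth_unbounded.
have [B hB] : exists B, forall F, uniq F -> sig F < B.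
  apply: contrapT => h; apply: bnd => B; apply: contrapT => h2; apply: h; exists B => F uF.
  by rewrite ltNge; apply/negP => h3; apply: h2; exists F.
have [del [N [del0 hN]]] : exists del : R, exists N, 0 < del /\ forall n, (N <= n)%N -> (0 < n)%N ->
    exists2 F, uniq F & expR del ^+ n < psum D F 0 n t.
  apply: contrapT => h; apply: nG => del N del0; apply: contrapT => h2; apply: h.
  exists del, N; split=> // n Nn n0; apply: contrapT => h3; apply: h2; exists n; split=> //.
  move=> F uF; rewrite leNgt; apply/negP => h4; apply: h3; exists F => //.
  by rewrite add0r mulrC expRM_natl in h4.
pose S := [set sig F | F in [set F | uniq F]].
have hS : has_sup S.
  split; first by exists (sig [::]), [::].
  by exists B => _ [F uF <-]; exact: ltW (hB F uF).
have sS F : uniq F -> sig F <= sup S.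
  by move=> uF; apply: sup_upper_bound => //; exists F.
have S0 : 0 < sup S.
  apply: lt_le_trans (sS [:: i1] isT); rewrite /sig big_seq1; exact: powR_gt0.
pose ge := expR (del / 2).
have ge1 : 1 < ge by rewrite /ge expR_gt1; lra.
have ge0 : 0 < ge by exact: expR_gt0.
(* Then [1 - e = expR (- del / 2)], so the restriction costs only half of the growth rate [del]. *)
pose e := 1 - ge^-1.
have e0 : 0 < e by rewrite /e subr_gt0 invf_lt1.
have e1 : e <= 1 by rewrite /e gerBl invr_ge0 ltW.
have Ct : 0 <= C `^ t * K `^ t * K `^ t by rewrite !mulr_ge0 // powR_ge0.
pose L := C `^ t * K `^ t * K `^ t + 1.
have L0 : 0 < L by rewrite /L ltr_wpDl.
(* The first bound keeps [sig F0] above half the supremum; the second makes the weight outside [F0]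
   small enough for [psum_restrict] with loss [e]. *)
have eta0 : 0 < Num.min (sup S / 2) (e * (sup S / 2) / L).
  by rewrite lt_min !divr_gt0 ?mulr_gt0 // divr_gt0.
have [_ [F0 /= uF0 <-] hF0] := sup_adherent eta0 hS.
have hF01 : sup S / 2 < sig F0.
  have : Num.min (sup S / 2) (e * (sup S / 2) / L) <= sup S / 2 by rewrite ge_min lexx.
  by move: hF0; lra.
have F0n : F0 != [::].
  by apply/eqP => E; move: hF01; rewrite E /sig big_nil; lra.
exists F0, ge.
suff : exists2 C0, 0 < C0 & forall n, C0 * ge ^+ n <= psum D F0 0 n t.
  by move=> [C0 C00 hC0]; exists C0; split.
apply: (@psum_growth_const F0 t ge N.+1) => // n Nn.
have [G uG hG] := hN n (ltnW Nn) (leq_ltn_trans (leq0n _) Nn).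
(* The alphabet [G] that realises the growth depends on [n]. It is merged with the fixed [F0] and
   then cut back to [F0], which is why the loss must be uniform over all larger alphabets. *)
pose F := undup (F0 ++ G).
have uF : uniq F by exact: undup_uniq.
have F0F : {subset F0 <= F} by move=> i iF0; rewrite mem_undup mem_cat iF0.
have GF : {subset G <= F} by move=> i iG; rewrite mem_undup mem_cat iG orbT.
have sigF : sig F0 <= sig F.
  (* [sig] is the level-one sum of the weight that reads off a one-letter word, so monotonicity of
     [psum] applies to it. *)
  have := @psum_mono (fun _ w => if w is [:: i] then a i else 0) F0 F 0 1 t uF0 uF F0F.
  by rewrite /psum !big_words1.
have hsub : C `^ t * K `^ t * K `^ t * (sig F - sig F0) <= e * sig F.
  have h1 : sig F - sig F0 <= e * (sup S / 2) / L.
    have : Num.min (sup S / 2) (e * (sup S / 2) / L) <= e * (sup S / 2) / L by rewrite ge_min lexx orbT.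
    by have := sS F uF; move: hF0; lra.
  have h2 : L * (sig F - sig F0) <= e * (sup S / 2) by rewrite mulrC -ler_pdivlMr.
  have h3 : e * (sup S / 2) <= e * sig F.
    by rewrite ler_pM2l // (le_trans (ltW hF01)).
  apply: le_trans h3; apply: le_trans h2; rewrite ler_wpM2r ?subr_ge0 //.
  by rewrite /L lerDl.
have e01 : 0 <= e <= 1 by rewrite ltW.
have := psum_restrict uF0 uF F0F e01 hsub n [::]; apply: le_trans.
have -> : 1 - e = ge^-1 by rewrite /e opprB addrC subrK.
apply: (@le_trans _ _ (ge^-1 ^+ n * expR del ^+ n)); last first.
  rewrite ler_wpM2l ?exprn_ge0 ?invr_ge0 ?(ltW ge0) // (le_trans (ltW hG)) //.
  exact: psum_mono.
rewrite -exprMn; apply: lerXn2r; rewrite ?nnegrE ?(ltW ge0) //.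
  by rewrite mulr_ge0 ?expR_ge0 // invr_ge0 ltW.
by rewrite /ge -expRN -expRD ler_expR; lra.
Qed.

End approx.

Lemma finite_growth (F : seq I) t : uniq F -> (forall i, i \in F) -> ~ growth_le D t 0 ->
  exists F g C0, [/\ uniq F, 1 < g, 0 < C0 & forall n, C0 * g ^+ n <= psum D F 0 n t].
Proof.
move=> uF hF nG.
have [del [N [del0 hN]]] : exists del : R, exists N, 0 < del /\ forall n, (N <= n)%N -> (0 < n)%N ->
    expR del ^+ n <= psum D F 0 n t.
  apply: contrapT => h; apply: nG => del N del0; apply: contrapT => h2; apply: h.
  exists del, N; split=> // n Nn n0; apply: contrapT => h3; apply: h2; exists n; split=> //.
  move=> G uG; apply: (@le_trans _ _ (psum D F 0 n t)); first by apply: psum_mono => // i _; exact: hF.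
  rewrite leNgt; apply/negP => h4; apply: h3; apply: ltW.
  by rewrite add0r mulrC expRM_natl in h4.
have F0n : F != [::].
  apply/eqP => E; have := hN N.+1 (leqnSn N) isT.
  by rewrite E /psum /= big_nil leNgt exprn_gt0 // expR_gt0.
have g1 : 1 < expR del by rewrite expR_gt1.
have [C0 C00 hC0] := @psum_growth_const F t (expR del) N.+1 F0n g1
   (fun n Nn => hN n (ltnW Nn) (leq_ltn_trans (leq0n _) Nn)).
by exists F, (expR del), C0.
Qed.

End one.
End growth.

(** * The lower pressure as a growth condition on finite sums *)

Lemma esum_leP {R : realType} {T : choiceType} (S : set T) (f : T -> R) (y : R) :
  (\esum_(x in S) (f x)%:E <= y%:E)%E <->
  (forall s : seq T, uniq s -> (forall x, x \in s -> S x) -> \sum_(x <- s) f x <= y).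
Proof.
split=> [h s us sS|h].
  rewrite -lee_fin; apply: le_trans h; rewrite -sumEFin fsbig_seq //.
  by apply: ereal_sup_ubound; exists [set` s].
apply: ge_ereal_sup => _ [F [finF FS] <-]; rewrite fsbig_finite //= sumEFin lee_fin.
apply: h; first exact: finmap.fset_uniq.
by move=> x; rewrite in_fset_set // inE => /FS.
Qed.

Lemma limn_einf_leP {R : realType} (u : (\bar R)^nat) (c : R) :
  (limn_einf u <= c%:E)%E <->
  (forall (del : R) N, 0 < del -> exists2 n, (N <= n)%N & (u n <= (c + del)%:E)%E).
Proof.
rewrite limn_einf_lim (cvg_lim _ (@cvg_einfs_sup _ u)) //.
split=> [h del N del0|h].
  have hN : (einfs u N < (c + del)%:E)%E.
    apply: le_lt_trans (_ : (c%:E < _)%E); last by rewrite lte_fin ltrDl.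
    by apply: le_trans h; apply: ereal_sup_ubound; exists N.
  have /ereal_inf_lt [_ [n /= Nn <-] hn] := hN.
  by exists n => //; exact: ltW.
apply: ge_ereal_sup => _ [N _ <-].
apply/lee_addgt0Pr => del del0; have [n Nn hn] := h del N del0.
by rewrite -EFinD; apply: le_trans hn; apply: ereal_inf_lbound; exists n.
Qed.

Lemma eln_leP {R : realType} (x : \bar R) (y : R) : (0 <= x)%E ->
  (eln x <= y%:E)%E <-> (x <= (expR y)%:E)%E.
Proof.
case: x => [r|_|]; [move=> r0 /=|by split; rewrite leye_eq|by rewrite leeNy_eq].
case: ifPn => [rp|]; rewrite !lee_fin.
  by rewrite -{2}(lnK rp) ler_expR.
rewrite -leNgt => rn; split=> _; first by rewrite (le_trans rn) // expR_ge0.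
exact: leNye.
Qed.

Section pressure.
Context {R : realType} {I : countType}.
Implicit Types (D : nat -> seq I -> R) (F G : seq I) (u v w : seq I).

(** A finite set [s] of words of length [n] lies among the words over the alphabet
    [undup (flatten s)]. *)
Lemma psum_boundedP D j n t y : psum_bounded D j n t y <->
  (\esum_(w in [set w : seq I | size w = n]) ((D j w) `^ t)%:E <= y%:E)%E.
Proof.
rewrite esum_leP; split=> [h s us sn|h F uF]; last first.
  apply: h; first exact: words_uniq.
  by move=> w; rewrite mem_words => /andP[/eqP].
have := h (undup (flatten s)) (undup_uniq _); apply: le_trans.
rewrite /psum [leRHS](bigID (mem s)) /= -[leLHS]addr0; apply: lerD; last first.
  by apply: sumr_ge0 => w _; exact: powR_ge0.
rewrite -[leRHS]big_filter le_eqVlt; apply/orP; left; apply/eqP; apply: perm_big.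
apply: uniq_perm => //; first by rewrite filter_uniq // words_uniq // undup_uniq.
move=> w; rewrite mem_filter /=; apply/idP/andP => [ws|[]//]; split => //.
rewrite mem_words (sn w ws) eqxx /=; apply/allP => a aw /=.
by rewrite mem_undup; apply/flattenP; exists w.
Qed.

Lemma pressure_leP D t (c : R) :
  (limn_einf (fun n : nat => (n%:R^-1)%:E *
     eln (\esum_(w in [set w : seq I | size w = n]) ((D 0%N w) `^ t)%:E))%E <= c%:E)%E <->
  growth_le D t c.
Proof.
rewrite limn_einf_leP.
have key n (y : R) : (0 < n)%N -> (((n%:R^-1)%:E *
     eln (\esum_(w in [set w : seq I | size w = n]) ((D 0%N w) `^ t)%:E))%E <= y%:E)%E <->
     psum_bounded D 0 n t (expR (y * n%:R)).
  move=> n0; rewrite psum_boundedP -eln_leP; last first.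
    by apply: esum_ge0 => w _; rewrite lee_fin powR_ge0.
  have n0' : 0 < (n%:R : R) by rewrite ltr0n.
  by rewrite lee_pdivrMl // -EFinM mulrC.
split=> h del N del0.
  (* Asking for [N.+1] excludes [n = 0], where the factor [n%:R^-1] is 0 by convention. *)
  have [n Nn hn] := h del N.+1 del0.
  have n0 : (0 < n)%N by exact: leq_ltn_trans (leq0n N) Nn.
  by exists n; split; [exact: ltnW| |apply/key].
by have [n [Nn n0 hn]] := h del N del0; exists n => //; apply/key.
Qed.

Lemma growth_le_mono D t s c K (eta : R) : quasi_mult D K -> 0 <= t <= s ->
  (forall w, D 0 w <= eta ^+ size w) -> 0 <= eta <= 1 ->
  growth_le D t c -> growth_le D s c.
Proof.
move=> [_ D0 _ _ _] /andP[t0 ts] De /andP[e0 e1] h del N del0.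
have [n [Nn n0 hn]] := h del N del0.
exists n; split=> // F uF; apply: le_trans (hn F uF); apply: ler_sum => w _.
apply: ger_powR => //; rewrite D0 /= (le_trans (De w)) // exprn_ile1 //.
Qed.

(** Passing from [q] to [s > q] multiplies the n-th sum by at most [eta ^ (n (s - q))]. *)
Lemma growth_le_small D q s K (eta : R) : quasi_mult D K -> 0 <= q < s ->
  (forall w, D 0 w <= eta ^+ size w) -> 0 < eta < 1 ->
  growth_le D q 0 -> forall (e : R) N, 0 < e -> exists2 n, (N <= n)%N & psum_bounded D 0 n s e.
Proof.
move=> [_ D0 _ _ _] /andP[q0 qs] De /andP[e0 e1] h e N ep.
pose b := - ln eta * (s - q).
have b0 : 0 < b by rewrite mulr_gt0 ?subr_gt0 // oppr_gt0 ln_lt0 // e0.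
have b20 : 0 < b / 2 by rewrite divr_gt0.
have eb1 : 1 < expR (b / 2) by rewrite expR_gt1.
have [N1 hN1] := pow_unbounded e^-1 eb1.
have [n [Nn n0 hn]] := h (b / 2) (maxn N N1) b20.
exists n; first by rewrite (leq_trans _ Nn) // leq_maxl.
move=> F uF.
apply: (@le_trans _ _ (expR (- b * n%:R) * psum D F 0 n q)).
  rewrite /psum mulr_sumr big_seq [leRHS]big_seq; apply: ler_sum => w.
  rewrite mem_words => /andP[/eqP sw _].
  have -> : s = (s - q) + q by rewrite subrK.
  rewrite powRD; last by rewrite (gt_eqF (D0 0 w)) implybT.
  rewrite ler_wpM2r ?powR_ge0 //.
  apply: (@le_trans _ _ ((eta ^+ n) `^ (s - q))).
    apply: ge0_ler_powR; rewrite ?nnegrE ?subr_ge0 ?(ltW qs) ?(ltW (D0 _ _)) ?exprn_ge0 ?(ltW e0) //.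
    by rewrite -sw.
  rewrite /powR gt_eqF ?exprn_gt0 // lnXn // ler_expR /b.
  rewrite -mulr_natl le_eqVlt; apply/orP; left; apply/eqP; ring.
apply: (@le_trans _ _ (expR (- b * n%:R) * expR ((0 + b / 2) * n%:R))).
  by rewrite ler_wpM2l ?expR_ge0 //; exact: hn.
rewrite -expRD add0r.
have -> : - b * n%:R + b / 2 * n%:R = - (n%:R * (b / 2)) by lra.
have h3 : e^-1 <= expR (n%:R * (b / 2)).
  by rewrite expRM_natl; apply: hN1; rewrite (leq_trans _ Nn) // leq_maxr.
have E0 : 0 < expR (n%:R * (b / 2)) by exact: expR_gt0.
by rewrite expRN -[leLHS]mul1r ler_pdivrMr // -ler_pdivrMl // mulr1.
Qed.

End pressure.

(** * Invariance of the growth condition under the shift *)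

Section shift.
Context {R : realType} {I : eqType}.
Variables (D : nat -> seq I -> R) (K : R).
Hypothesis HD : quasi_mult D K.
Implicit Types (F : seq I) (t : R).

Let D_gt0 j w : 0 < D j w. Proof. by case: HD. Qed.
Let K_gt0 : 0 < K. Proof. by case: HD => h _ _ _ _; exact: lt_le_trans h. Qed.

(** For the random system this is the passage from [l] to [T l]. *)
Definition shiftw (j : nat) (w : seq I) : R := D j.+1 w.

Lemma shiftw_quasi_mult : quasi_mult shiftw K.
Proof.
case: HD => h1 h2 h3 h4 h5; split.
- exact: h1.
- by move=> j w; exact: h2.
- by move=> j; exact: h3.
- by move=> j u v; exact: h4.
- by move=> j u v; exact: h5.
Qed.

Lemma expR_absorb (M del : R) : 0 < del ->
  exists N, forall n, (N <= n)%N -> M * expR (del / 2 * n%:R) <= expR (del * n%:R).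
Proof.
move=> del0; have d20 : 0 < del / 2 by rewrite divr_gt0.
have ed1 : 1 < expR (del / 2) by rewrite expR_gt1.
have [N hN] := pow_unbounded M ed1.
exists N => n /hN h; have -> : del * n%:R = n%:R * (del / 2) + del / 2 * n%:R by lra.
by rewrite expRD expRM_natl ler_wpM2r ?expR_ge0.
Qed.

(** Prepending a fixed letter [i] bounds the shifted sum of length [n] by [K ^ t / b] times the sum
    of length [n.+1]; such a factor does not change the exponential rate. *)
Lemma growth_le_shift t : 0 <= t -> inhabited I -> growth_le D t 0 -> growth_le shiftw t 0.
Proof.
move=> t0 [i] h del N del0; pose b := D 0 [:: i] `^ t.
have b0 : 0 < b by exact: powR_gt0.
have [N1 hN1] := expR_absorb (K `^ t / b * expR (del / 2)) del0.
have d20 : 0 < del / 2 by rewrite divr_gt0.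
(* The length found is [n.+1]; [N.+2] leaves a positive [n] above [N] once one letter has been
   removed. *)
have [[|n] [Nn // _ hn]] := h (del / 2) (maxn N.+2 N1.+1) d20.
have /andP[Nn1 Nn2] : (N < n)%N && (N1 <= n)%N by move: Nn; rewrite geq_max.
exists n; split; [exact: ltnW|exact: leq_ltn_trans Nn1|].
move=> F uF; pose G := undup (i :: F).
have uG : uniq G by exact: undup_uniq.
have FG : psum shiftw F 0 n t <= psum D G 1 n t.
  by apply: psum_mono => // j jF; rewrite mem_undup inE jF orbT.
apply: (le_trans FG).
have h1 := psum_cat_ge HD G 0 1 n t0; rewrite add0n add1n in h1.
have h2 : b <= psum D G 0 1 t.
  apply: (@psum_nth_ge _ _ D G 0 1 t [:: i]); rewrite mem_words /= andbT.
  by rewrite mem_undup inE eqxx.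
have h3 : b * psum D G 1 n t <= K `^ t * expR ((0 + del / 2) * n.+1%:R).
  apply: (@le_trans _ _ (psum D G 0 1 t * psum D G 1 n t)).
    by rewrite ler_wpM2r // psum_ge0.
  by apply: (le_trans h1); rewrite ler_wpM2l ?powR_ge0 //; exact: hn.
rewrite add0r in h3; rewrite add0r; apply: le_trans (hN1 n Nn2).
have -> : K `^ t / b * expR (del / 2) * expR (del / 2 * n%:R) =
    K `^ t * expR (del / 2 * n.+1%:R) / b.
  have -> : del / 2 * n.+1%:R = del / 2 + del / 2 * n%:R by rewrite -natr1; lra.
  by rewrite expRD; ring.
by rewrite ler_pdivlMr // mulrC.
Qed.

(** Restoring the first level multiplies the sums by at most the first level sum, which over an
    infinite alphabet must be assumed finite. *)
Lemma growth_le_unshift t y : 0 <= t -> psum_bounded D 0 1 t y ->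
  growth_le shiftw t 0 -> growth_le D t 0.
Proof.
move=> t0 hy h del N del0.
have [N1 hN1] := expR_absorb y del0.
have d20 : 0 < del / 2 by rewrite divr_gt0.
have [n [Nn _ hn]] := h (del / 2) (maxn N N1) d20.
have /andP[Nn1 Nn2] : (N <= n)%N && (N1 <= n)%N by move: Nn; rewrite geq_max.
have y0 : 0 <= y by apply: le_trans (hy [::] isT); exact: psum_ge0.
exists n.+1; split=> //; first exact: leqW.
move=> F uF; rewrite add0r; apply: (@le_trans _ _ (expR (del * n%:R))); last first.
  by rewrite ler_expR ler_pM2l // ler_nat.
apply: le_trans (hN1 n Nn2).
apply: (@le_trans _ _ (y * psum shiftw F 0 n t)); last first.
  by rewrite ler_wpM2l // -[del / 2]add0r; exact: hn.
rewrite /psum big_words_cons; apply: (@le_trans _ _ (\sum_(a <- F) D 0 [:: a] `^ t * psum D F 1 n t)).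
  by apply: ler_sum => a _; have := psum_prefix_le HD F 0 [:: a] n t0.
rewrite -mulr_suml; apply: ler_wpM2r; first exact: psum_ge0.
by have := hy F uF; rewrite /psum big_words1.
Qed.

(** Every first letter is continued by the same word [nseq n i], whose weight is positive. *)
Lemma psum_bounded_first j n t y : 0 <= t -> inhabited I -> (0 < n)%N ->
  psum_bounded D j n t y -> exists y', psum_bounded D j 1 t y'.
Proof.
move=> t0 [i]; case: n => // n _ h.
pose b := D j.+1 (nseq n i) `^ t.
have b0 : 0 < b by exact: powR_gt0.
exists (K `^ t * y / b) => F uF; pose G := undup (i :: F).
have uG : uniq G by exact: undup_uniq.
apply: (@le_trans _ _ (psum D G j 1 t)).
  by apply: psum_mono => // k kF; rewrite mem_undup inE kF orbT.
rewrite ler_pdivlMr //; apply: (@le_trans _ _ (psum D G j 1 t * psum D G j.+1 n t)).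
  rewrite ler_wpM2l ?psum_ge0 //; apply: psum_nth_ge.
  rewrite mem_words size_nseq eqxx /=; apply/allP => k /nseqP[-> _] /=.
  by rewrite mem_undup mem_head.
have := psum_cat_ge HD G j 1 n t0; rewrite addn1 add1n => /le_trans; apply.
by rewrite ler_wpM2l ?powR_ge0 //; exact: h.
Qed.

End shift.

(** * Hausdorff measure of the limit set *)

Section hausdorff.
Context {R : realType} {d : nat}.
Local Notation V := 'rV[R]_d.
Local Notation sd := (@sqrtdim R d).

Lemma ediam_ge0 (A : set V) : (0 <= ediam A)%E.
Proof. by rewrite /ediam le_max lexx. Qed.

Lemma ediam_le (A : set V) (r : R) : 0 <= r ->
  (forall x y, A x -> A y -> enorm (x - y) <= r) -> (ediam A <= r%:E)%E.
Proof.
move=> r0 h; rewrite /ediam ge_max lee_fin r0 /=.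
by apply: ge_ereal_sup => _ [x Ax [y Ay <-]]; rewrite lee_fin; exact: h.
Qed.

Lemma ediam_ge (A : set V) x y : A x -> A y -> ((enorm (x - y))%:E <= ediam A)%E.
Proof.
move=> Ax Ay; rewrite /ediam le_max; apply/orP; right.
by apply: ereal_sup_ubound; exists x => //; exists y.
Qed.

Lemma epow_ge0 (x : \bar R) s : (0 <= epow x s)%E.
Proof. by case: x => [r| |] //=; rewrite lee_fin powR_ge0. Qed.

Lemma epow_le (x : \bar R) (r s : R) : 0 <= s -> (0 <= x)%E -> (x <= r%:E)%E ->
  (epow x s <= (r `^ s)%:E)%E.
Proof.
case: x => [q| |] //= s0 q0 qr; rewrite lee_fin in q0; rewrite lee_fin in qr.
by rewrite lee_fin; apply: ge0_ler_powR; rewrite ?nnegrE // (le_trans q0).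
Qed.

Lemma hausdorff_delta_ge0 s delta (A : set V) : (0 <= hausdorff_delta s delta A)%E.
Proof.
apply: le_ereal_inf_tmp => _ [U _ <-].
by apply: nneseries_ge0 => k _ _; exact: epow_ge0.
Qed.

Lemma hausdorff_measure_eq0P s (A : set V) :
  hausdorff_measure s A = 0%E <->
  (forall delta e : R, 0 < delta -> 0 < e -> exists U : nat -> set V,
    [/\ A `<=` \bigcup_k U k, (forall k, (ediam (U k) <= delta%:E)%E) &
        (\sum_(0 <= k <oo) epow (ediam (U k)) s < e%:E)%E]).
Proof.
split=> [h delta e delta0 e0|h].
  have : (hausdorff_delta s delta A < e%:E)%E.
    apply: (@le_lt_trans _ _ 0%E); last by rewrite lte_fin.
    by rewrite -h; apply: ereal_sup_ubound; exists delta.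
  by move=> /ereal_inf_lt [_ [U [AU Ud] <-] hU]; exists U.
apply/eqP; rewrite eq_le; apply/andP; split.
  apply: ge_ereal_sup => _ [delta delta0 <-]; apply/lee_addgt0Pr => e e0.
  have [U [AU Ud hU]] := h delta e delta0 e0.
  by rewrite add0e; apply: le_trans (ltW hU); apply: ereal_inf_lbound; exists U.
apply: (@le_trans _ _ (hausdorff_delta s 1 A)); first exact: hausdorff_delta_ge0.
by apply: ereal_sup_ubound; exists 1 => //; exact: ltr01.
Qed.

Lemma hausdorff_dim_le (A : set V) (c : \bar R) : (0 <= c)%E ->
  (forall s : R, (c < s%:E)%E -> hausdorff_measure s A = 0%E) -> (hausdorff_dim A <= c)%E.
Proof.
move=> c0 h; case: c c0 h => [c| |] // c0 h; last by rewrite leey.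
apply/lee_addgt0Pr => e e0; rewrite -EFinD; apply: ereal_inf_lbound; exists (c + e) => //.
rewrite lee_fin in c0; split; first by lra.
by apply: h; rewrite lte_fin; lra.
Qed.

End hausdorff.

Section upper.
Context {R : realType} {d : nat} {I : countType}.
Local Notation V := 'rV[R]_d.
Local Notation sd := (@sqrtdim R d).
Variables (X : set V) (Phi : nat -> I -> V -> V) (D : nat -> seq I -> R) (M eta : R).
Hypothesis D0 : forall w, 0 < D 0%N w.
Hypothesis Deta : forall w, D 0%N w <= eta ^+ size w.
Hypothesis eta01 : 0 < eta < 1.
Hypothesis M0 : 0 < M.
Hypothesis HM : forall w x y, X x -> X y ->
  `|compL Phi 0 w x - compL Phi 0 w y| <= M * D 0%N w.

Lemma geometric_small (e : R) : 0 < e -> exists N, forall n, (N <= n)%N -> eta ^+ n <= e.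
Proof.
move=> e0; case/andP: eta01 => h0 h1.
have g1 : 1 < eta^-1 by rewrite invf_gt1.
have [N hN] := pow_unbounded e^-1 g1.
exists N => n /hN h; rewrite exprVn in h.
by rewrite -[leLHS]invrK -[leRHS]invrK lef_pV2 // posrE invr_gt0 // exprn_gt0.
Qed.

Lemma hausdorff_measure0 s : 0 < s ->
  (forall (e : R) N, 0 < e -> exists2 n, (N <= n)%N & psum_bounded D 0 n s e) ->
  hausdorff_measure s (limit_set X Phi) = 0%E.
Proof.
move=> s0 hs; apply/hausdorff_measure_eq0P => delta e delta0 e0.
pose c := sd * M.
have c0 : 0 < c by rewrite mulr_gt0 // sqrtdim_gt0.
have [N hN] := geometric_small (divr_gt0 delta0 c0).
have e'0 : 0 < e / 2 / c `^ s by rewrite !divr_gt0 // powR_gt0.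
have [n Nn hn] := hs _ N e'0.
(* The cylinders are indexed through [pickle_inv]; an index that codes no word of length [n] gets
   the empty set, which contributes 0 because [s > 0]. *)
pose U k : set V := if pickle_inv k is Some w then
   (if size (w : seq I) == n then compL Phi 0 w @` X else set0) else set0.
pose b k : R := if pickle_inv k is Some w then
   (if size (w : seq I) == n then c * D 0%N w else 0) else 0.
have b0 k : 0 <= b k.
  by rewrite /b; case: (pickle_inv _) => // w; case: ifP => // _; rewrite mulr_ge0 // ltW.
have hU k : (ediam (U k) <= (b k)%:E)%E.
  apply: ediam_le => //; rewrite /U /b; case: (pickle_inv _) => // w; case: ifP => // sw.
  move=> _ _ [x Xx <-] [y Xy <-]; rewrite (le_trans (enorm_le_norm _)) // /c -mulrA.
  by rewrite ler_pM2l ?sqrtdim_gt0 // HM.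
exists U; split.
- move=> x /(_ n Logic.I) [w /= sw wx]; exists (pickle w) => //.
  by rewrite /U pickleK_inv sw eqxx.
- move=> k; apply: (le_trans (hU k)); rewrite lee_fin /b.
  case: (pickle_inv _) => [w|]; last exact: ltW.
  case: eqP => sw; last exact: ltW.
  rewrite mulrC -ler_pdivlMr // (le_trans (Deta w)) // sw; exact: hN.
apply: (@le_lt_trans _ _ (e / 2)%:E); last by rewrite lte_fin; lra.
apply: (@le_trans _ _ (\sum_(0 <= k <oo) (b k `^ s)%:E)%E).
  by apply: lee_nneseries => [k _ _|k _]; [exact: epow_ge0|apply: epow_le; rewrite ?ediam_ge0 // ltW].
rewrite nneseries_esumT; last by move=> k; rewrite lee_fin powR_ge0.
apply/esum_leP => ks uks _.
pose ws := [seq w <- pmap (@pickle_inv (seq I)) ks | size w == n].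
have uws : uniq ws by rewrite filter_uniq // (pmap_uniq (@pickle_invK _)).
have -> : \sum_(k <- ks) b k `^ s = c `^ s * \sum_(w <- ws) D 0%N w `^ s.
  rewrite mulr_sumr /ws big_filter; elim: ks {uks ws uws} => [|k ks IH].
    by rewrite !big_nil.
  rewrite big_cons IH /= /b; case: (pickle_inv k) => [w|] /=.
    rewrite [in RHS]big_cons; case: ifP => // _; first by rewrite powRM ?ltW.
    by rewrite powR0 ?gt_eqF // add0r.
  by rewrite powR0 ?gt_eqF // add0r.
rewrite mulrC -ler_pdivlMr ?powR_gt0 //.
have /psum_boundedP/esum_leP := hn; apply => // w.
by rewrite mem_filter => /andP[/eqP].
Qed.

End upper.

Section lower.
Context {R : realType} {d : nat} {I : countType}.
Local Notation V := 'rV[R]_d.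
Variables (X : set V) (Phi : nat -> I -> V -> V) (D : nat -> seq I -> R) (K eta : R).
Hypothesis HD : quasi_mult D K.
Hypothesis Deta : forall w, D 0%N w <= eta ^+ size w.
Hypothesis eta01 : 0 < eta < 1.
Hypothesis cX : compact X.
Hypothesis Xne : X !=set0.
Hypothesis PhiX : forall j w x, X x -> X (compL Phi j w x).
Hypothesis Phic : forall j w x, X x -> {for x, continuous (compL Phi j w)}.
Variable N : nat.
Hypothesis hN : forall n x (r : R) (W : seq (seq I)), 0 < r -> uniq W ->
    (forall w, w \in W -> [/\ size w = n, r <= D 0%N w &
       exists2 y, X y & `|compL Phi 0 w y - x| <= r]) -> (size W <= N)%N.

Let E (F : seq I) n : set V := [set y | exists2 w, w \in words F n & (compL Phi 0 w @` X) y].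

Lemma level_closed F n : closed (E F n).
Proof.
rewrite /E; elim: (words F n) => [|w s IH].
  rewrite (_ : [set y | _] = set0); first exact: closed0.
  by apply/seteqP; split=> // y [w].
rewrite (_ : [set y | _] = (compL Phi 0 w @` X) `|`
    [set y | exists2 w, w \in s & (compL Phi 0 w @` X) y]).
  apply: closedU => //; apply: compact_closed; first exact: norm_hausdorff.
  apply: continuous_compact => //; apply: continuous_in_subspaceT => x /[!inE] Xx.
  exact: Phic.
apply/seteqP; split=> y.
  by move=> [v]; rewrite inE => /orP[/eqP ->|vs] hv; [left|right; exists v].
by move=> [hv|[v vs hv]]; [exists w => //; exact: mem_head|exists v => //; rewrite inE vs orbT].
Qed.

Lemma level_mono F k m : E F (k + m) `<=` E F k.
Proof.
move=> y [w wF [x Xx <-]].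
move: wF; rewrite mem_words => /andP[/eqP sw wF].
exists (take k w); first rewrite mem_words size_takel ?sw ?leq_addr // eqxx /=.
  by apply/allP => a /mem_take; exact: (allP wF).
exists (compL Phi (0 + size (take k w)) (drop k w) x); first exact: PhiX.
by rewrite -compL_cat cat_take_drop.
Qed.

Lemma level_X F n : E F n `<=` X.
Proof. by move=> y [w _ [x Xx <-]]; exact: PhiX. Qed.

(** Otherwise each level [n] has a point [p n] outside the first [n] open sets. A cluster point of
    [p] lies in every level, these being closed and decreasing, hence in the limit set, yet in none
    of the open sets. *)
Lemma level_cover F (O : nat -> set V) : (forall k, open (O k)) ->
  limit_set X Phi `<=` \bigcup_k O k ->
  exists n0, forall n, (n0 <= n)%N -> forall y, E F n y -> exists2 k, (k < n0)%N & O k y.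
Proof.
move=> oO JO; apply: contrapT => h.
have /choice[p hp] : forall n, exists p, E F n p /\ forall k, (k < n)%N -> ~ O k p.
  move=> n; apply: contrapT => h1; apply: h; exists n => m nm y Ey.
  apply: contrapT => h2; apply: h1; exists y; split.
    by apply: (@level_mono F n (m - n)); rewrite subnKC.
  by move=> k kn Ok; apply: h2; exists k.
have pX : (p @ \oo) X by exists 0%N => // n _; apply: (@level_X F n); exact: (hp n).1.
have [q [Xq cq]] := cX (fmap_proper_filter p eventually_filter) pX.
have Eq n : E F n q.
  apply: level_closed => B nB.
  have [z [Ez Bz]] : (E F n `&` B) !=set0.
    apply: cq => //; exists n => // m /= nm.
    by apply: (@level_mono F n (m - n)); rewrite subnKC //; exact: (hp m).1.
  by exists z.
have Jq : limit_set X Phi q.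
  move=> n _; have [w + hw] := Eq n; rewrite mem_words => /andP[/eqP sw _].
  by exists w.
have [k _ Okq] := JO q Jq.
have [z [nOz Oz]] : (~` O k `&` O k) !=set0.
  apply: cq; last by apply: open_nbhs_nbhs.
  by exists k.+1 => // m /= km; exact: (hp m).2.
exact: nOz.
Qed.

(** Mass distribution on finite levels: by compactness a cover of the limit set covers
    some level of the subsystem [F], and by [ball_mass] each covering set of diameter
    [r] carries at most a proportion [O(r^t)] of the level sum. *)
Lemma hausdorff_measure_gt0 F t g C0 : 0 < t -> uniq F -> 1 < g -> 0 < C0 ->
  (forall n, C0 * g ^+ n <= psum D F 0 n t) ->
  hausdorff_measure t (limit_set X Phi) <> 0%E.
Proof.
move=> t0 uF g1 C00 hg /hausdorff_measure_eq0P H0.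
have [x0 Xx0] := Xne.
have K0 : 0 <= K by case: HD => K1 _ _ _ _; rewrite (le_trans _ K1).
pose C2 := N%:R * (size F)%:R * K `^ t / C0 / (g - 1).
have C20 : 0 <= C2.
  by rewrite /C2 !mulr_ge0 ?powR_ge0 ?ler0n // invr_ge0 ?ltW // subr_gt0.
(* The [t]-th powers of the radii chosen below sum to at most [2 * e <= 1/2], so each radius is less
   than 1; and [C2 * (2 * e) < 1] gives the final contradiction. *)
pose e := (4 * (C2 + 1))^-1.
have e0 : 0 < e by rewrite invr_gt0 mulr_gt0 // ltr_wpDl.
have e4 : e <= 1 / 4.
  rewrite /e invfM mul1r ler_piMr ?invr_ge0 // invf_le1 ?ltr_wpDl // lerDr //.
have eC : C2 * (2 * e) < 1.
  have : (C2 + 1) * (4 * e) = 1 by rewrite /e invfM; field; rewrite gt_eqF // ltr_wpDl.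
  by have : 0 <= C2 * e by [rewrite mulr_ge0 // ltW]; lra.
have [U [JU Ud Us]] := H0 1 e ltr01 e0.
pose dk k := fine (ediam (U k)).
have dkE k : ediam (U k) = (dk k)%:E.
  rewrite /dk fineK // ge0_fin_numE ?ediam_ge0 //.
  by apply: le_lt_trans (Ud k) _; rewrite ltry.
have dk0 k : 0 <= dk k by rewrite -lee_fin -dkE ediam_ge0.
have sumd n : \sum_(k < n) dk k `^ t < e.
  rewrite -lte_fin; apply: le_lt_trans Us.
  rewrite -sumEFin -(big_mkord xpredT (fun k => (dk k `^ t)%:E)).
  rewrite (eq_bigr (fun k => epow (ediam (U k)) t)); last by move=> k _; rewrite dkE.
  by apply: nneseries_lim_ge => k _ _; exact: epow_ge0.
(* A covering set may have diameter 0. The summable extra term gives positive radii, and thus open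
   balls containing the covering sets. *)
pose rt k := dk k `^ t + e / 2 ^+ k.+1.
have ek k : 0 < e / 2 ^+ k.+1 by rewrite divr_gt0 // exprn_gt0.
have rt0 k : 0 < rt k by rewrite /rt ltr_wpDl ?powR_ge0.
pose r k := rt k `^ t^-1.
have r0 k : 0 < r k by exact: powR_gt0.
have rE k : r k `^ t = rt k by rewrite /r -powRrM mulVf ?gt_eqF // powRr1 // ltW.
have sume n : \sum_(k < n) e / 2 ^+ k.+1 <= e.
  suff -> : \sum_(k < n) e / 2 ^+ k.+1 = e * (1 - (2 ^+ n)^-1).
    by rewrite ler_piMr ?ltW // gerBl invr_ge0 exprn_ge0.
  elim: n => [|n IH]; first by rewrite big_ord0 expr0 invr1 subrr mulr0.
  rewrite big_ord_recr /= IH exprS; field.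
  by rewrite expf_neq0.
have sumr n : \sum_(k < n) r k `^ t <= 2 * e.
  under eq_bigr => k _ do rewrite rE /rt.
  rewrite big_split /= mulr_natl mulr2n.
  by apply: lerD; [exact: ltW (sumd n)|exact: sume].
have r1 k : r k < 1.
  have E1 : (1 : R) `^ t^-1 = 1 by rewrite powR1.
  rewrite -[ltRHS]E1 /r; apply: gt0_ltr_powR; rewrite ?invr_gt0 ?nnegrE ?ler01 ?(ltW (rt0 k)) //.
  rewrite -rE; apply: (@le_lt_trans _ _ (2 * e)); last by lra.
  apply: le_trans (sumr k.+1); rewrite big_ord_recr /= lerDr.
  by apply: sumr_ge0 => i _; exact: powR_ge0.
have dr k : dk k < r k.
  have h : dk k `^ t < r k `^ t by rewrite rE /rt ltrDl.
  rewrite ltNge; apply/negP => h2; move: h; apply/negP; rewrite -leNgt.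
  by apply: ge0_ler_powR; rewrite ?nnegrE ?dk0 ?(ltW (r0 k)) ?(ltW t0).
have /choice[c hc] : forall k, exists c, forall y, U k y -> `|y - c| < r k.
  move=> k; have [[c Uc]|nU] := pselect (U k !=set0); last first.
    by exists x0 => y Uy; exfalso; apply: nU; exists y.
  exists c => y Uy; apply: le_lt_trans (dr k).
  apply: (le_trans (norm_le_enorm _)); rewrite -lee_fin -dkE; exact: ediam_ge.
pose O k := [set y : V | `|y - c k| < r k].
have oO k : open (O k).
  apply: normP_open => y /= hy; exists (r k - `|y - c k|); first by rewrite subr_gt0.
  move=> z zy; rewrite /O /=; have -> : z - c k = (z - y) + (y - c k) by rewrite addrA subrK.
  by rewrite (le_lt_trans (ler_normD _ _)) //; lra.
have JO : limit_set X Phi `<=` \bigcup_k O k.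
  by move=> y /JU[k _ Uy]; exists k => //; exact: hc.
have [n0 hn0] := @level_cover F O oO JO.
(* Only the first [n0] balls are needed, so one level is deep enough for all their radii. *)
have [n1 hn1] : exists n1, forall n, (n1 <= n)%N -> forall k, (k < n0)%N -> eta ^+ n <= r k.
  elim: (n0) => [|m [n1 IH]]; first by exists 0%N.
  have [n2 h2] := geometric_small eta01 (r0 m).
  exists (maxn n1 n2) => n; rewrite geq_max => /andP[h h'] k; rewrite ltnS leq_eqVlt.
  by move=> /orP[/eqP ->|]; [exact: h2|exact: IH].
pose n := maxn n0 n1.
pose Q k : pred (seq I) := fun w => `[< exists2 y, X y & `|compL Phi 0 w y - c k| <= r k >].
have Qpre k u v : Q k (u ++ v) -> Q k u.
  move=> /asboolP[y Xy]; rewrite compL_cat => hy; apply/asboolP.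
  by exists (compL Phi (0 + size u) v y) => //; exact: PhiX.
have QN k m : (size [seq u <- words F m | ((r k < D 0%N u)%R && Q k u)%B] <= N)%N.
  apply: (hN (n := m) (x := c k) (r0 k)); first by rewrite filter_uniq // words_uniq.
  move=> w; rewrite mem_filter mem_words => /andP[/andP[/ltW rD /asboolP hw] /andP[/eqP sw _]].
  by split.
have mass k : (k < n0)%N -> \sum_(w <- words F n | Q k w) D 0%N w `^ t <=
    C2 * r k `^ t * psum D F 0 n t.
  move=> kn; have r01 : 0 < r k < 1 by rewrite r0 r1.
  apply: (@ball_mass R I D K HD F t (r k) eta g C0 N (Q k) t0 r01 (Qpre k) (QN k) g1 C00 hg Deta n).
  by apply: hn1 => //; rewrite leq_maxr.
have P0 : 0 < psum D F 0 n t.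
  by apply: lt_le_trans (hg n); rewrite mulr_gt0 // exprn_gt0 // (lt_trans ltr01).
(* Each word is counted for at least one ball, namely one that contains its point
   [compL Phi 0 w x0]. *)
have : psum D F 0 n t <= \sum_(k < n0) \sum_(w <- words F n | Q k w) D 0%N w `^ t.
  under [leRHS]eq_bigr => k _ do rewrite big_mkcond.
  rewrite exchange_big /= /psum big_seq [leRHS]big_seq; apply: ler_sum => w wF.
  have Ew : E F n (compL Phi 0 w x0) by exists w => //; exists x0.
  have [k kn Okw] := hn0 n (leq_maxl _ _) _ Ew.
  rewrite (bigD1 (Ordinal kn)) //= ifT; last first.
    by apply/asboolP; exists x0 => //; exact: ltW.
  by rewrite lerDl; apply: sumr_ge0 => i _; case: ifP => // _; exact: powR_ge0.
apply/negP; rewrite -ltNge.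
apply: (@le_lt_trans _ _ (\sum_(k < n0) C2 * r k `^ t * psum D F 0 n t)).
  by apply: ler_sum => k _; exact: mass.
rewrite -mulr_suml -mulr_sumr gtr_pMl //; apply: le_lt_trans eC.
by rewrite ler_wpM2l.
Qed.

End lower.

(** * Measurability and the zero-one law *)

Section measurable_predicates.
Context {R : realType} {dL : measure_display} {Lam : measurableType dL}.
Implicit Types (f g : Lam -> R).

Lemma measurable_forall {T : countType} (P : T -> Lam -> Prop) :
  (forall x, measurable [set l | P x l]) -> measurable [set l | forall x, P x l].
Proof.
move=> mP; pose A (n : nat) : set Lam := if unpickle n is Some x then [set l | P x l] else setT.
rewrite (_ : [set l | _] = \bigcap_n A n).
  apply: bigcapT_measurable => n; rewrite /A; case: (unpickle n) => // x; exact: mP.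
apply/seteqP; split=> l /= h.
  by move=> n _; rewrite /A; case: (unpickle n).
by move=> x; have := h (pickle x) Logic.I; rewrite /A pickleK.
Qed.

Lemma measurable_exists (P : nat -> Lam -> Prop) :
  (forall n, measurable [set l | P n l]) -> measurable [set l | exists n, P n l].
Proof.
move=> mP; rewrite (_ : [set l | _] = \bigcup_n [set l | P n l]).
  exact: bigcupT_measurable.
by apply/seteqP; split=> [l [n Pn]|l [n _ Pn]]; exists n.
Qed.

Lemma measurable_cstP (P : Prop) : measurable [set l : Lam | P].
Proof.
have [p|np] := pselect P.
  by rewrite (_ : [set _ | _] = setT) //; apply/seteqP; split.
by rewrite (_ : [set _ | _] = set0) //; apply/seteqP; split.
Qed.

Lemma measurable_orP (P Q : Lam -> Prop) : measurable [set l | P l] ->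
  measurable [set l | Q l] -> measurable [set l | P l \/ Q l].
Proof. exact: measurableU. Qed.

Lemma measurable_andP (P Q : Lam -> Prop) : measurable [set l | P l] ->
  measurable [set l | Q l] -> measurable [set l | P l /\ Q l].
Proof. exact: measurableI. Qed.

Lemma measurable_le f g : measurable_fun setT f -> measurable_fun setT g ->
  measurable [set l | f l <= g l].
Proof.
move=> mf mg; have := measurable_funB mg mf measurableT (measurable_itv `[0, +oo[).
rewrite setTI; congr (measurable _); apply/seteqP; split=> l /=;
  by rewrite in_itv /= andbT subr_ge0.
Qed.

Lemma measurable_fun_le f : (forall c, measurable [set l | f l <= c]) -> measurable_fun setT f.
Proof.
move=> h mD; apply: (measurability _ (RGenOInfty.measurableE R)) => //.
move=> _ [_ [x ->] <-]; rewrite setTI.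
rewrite (_ : _ @^-1` _ = ~` [set l | f l <= x]); first exact: measurableC.
apply/seteqP; split=> l /=; rewrite in_itv /= andbT ltNge; first by move/negP.
by move/negP.
Qed.

Lemma emeasurable_fun_le (f : Lam -> \bar R) :
  (forall c : R, measurable [set l | (f l <= c%:E)%E]) -> measurable_fun setT f.
Proof.
move=> h mD; apply: (measurability _ (ErealGenOInfty.measurableE R)) => //.
move=> _ [_ [x ->] <-]; rewrite setTI.
rewrite (_ : _ @^-1` _ = ~` [set l | (f l <= x%:E)%E]); first exact: measurableC.
apply/seteqP; split=> l /=; rewrite in_itv /= andbT ltNge; first by move/negP.
by move/negP.
Qed.

End measurable_predicates.

Section evaluation.
Context {R : realType} {d : nat} {dL : measure_display} {Lam : measurableType dL}.
Local Notation V := 'rV[R]_d.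

Definition ratv (q : 'rV[rat]_d) : V := map_mx ratr q.

Lemma ratv_dense (x : V) (s : R) : 0 < s -> exists q, `|ratv q - x| < s.
Proof.
move=> s0.
have /choice[q hq] : forall j, exists q : rat, `|ratr q - x ord0 j| < s / 2.
  move=> j; have : x ord0 j - s / 2 < x ord0 j + s / 2 by lra.
  move=> /rat_in_itvoo[q]; rewrite in_itv /= => /andP[h1 h2]; exists q.
  by rewrite ltr_norml; apply/andP; split; lra.
exists (\row_j q j); apply: (@le_lt_trans _ _ (s / 2)); last by lra.
apply: norm_le_coord; first by lra.
by move=> j; rewrite !mxE; exact: ltW.
Qed.

(** Caratheodory: a map continuous in the point and measurable in the parameter can be
    evaluated at a measurable point, its values being determined on the rational
    points of the interior of [X]. *)
Lemma measurable_eval (X : set V) (f : Lam -> V -> V) (h : Lam -> V) :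
  X `<=` closure (interior X) ->
  (forall x j, X x -> measurable_fun setT (fun l => f l x ord0 j)) ->
  (forall l x, X x -> {for x, continuous (f l)}) ->
  (forall l, X (h l)) -> (forall j, measurable_fun setT (fun l => h l ord0 j)) ->
  forall j, measurable_fun setT (fun l => f l (h l) ord0 j).
Proof.
move=> Xcl mf cf hX mh j; apply: measurable_fun_le => c.
(* For all rational interior points close enough to [h l], the value is at most [c + 1/(n+1)]. The
   implication is written as a disjunction of measurable conditions, and closeness is a sum over
   coordinates because [h] is measurable coordinatewise. *)
pose A l := forall (n : nat), exists N : nat, forall q : 'rV[rat]_d,
  (~ interior X (ratv q) \/ N.+1%:R^-1 <= \sum_(i < d) `|h l ord0 i - ratv q ord0 i|) \/
  (interior X (ratv q) /\ f l (ratv q) ord0 j <= c + n.+1%:R^-1).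
have dist (x y : V) : `|x - y| <= \sum_(i < d) `|x ord0 i - y ord0 i|.
  apply: norm_le_coord; first exact: sumr_ge0.
  by move=> i; rewrite !mxE (bigD1 i) //= lerDl; exact: sumr_ge0.
have dist2 (x y : V) : \sum_(i < d) `|x ord0 i - y ord0 i| <= d%:R * `|x - y|.
  apply: (@le_trans _ _ (\sum_(i < d) `|x - y|)).
    apply: ler_sum => i _; have := coord_le_norm (x - y) i; by rewrite !mxE.
  by rewrite sumr_const card_ord mulr_natl.
have -> : [set l | f l (h l) ord0 j <= c] = [set l | A l].
  apply/seteqP; split=> l /= hl.
    move=> n; have : 0 < n.+1%:R^-1 :> R by rewrite invr_gt0.
    set e := n.+1%:R^-1 => e0.
    have := cf l (h l) (hX l); move=> /cvgrPdist_lt /(_ _ e0) /nbhs_normP[s s0 hs].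
    pose N := Num.truncn s^-1; exists N => q.
    have [iq|nq] := pselect (interior X (ratv q)); last by left; left.
    have [|hq] := lerP (N.+1%:R^-1) (\sum_(i < d) `|h l ord0 i - ratv q ord0 i|).
      by left; right.
    right; split=> //; have qs : `|ratv q - h l| < s.
      rewrite distrC (le_lt_trans (dist _ _)) // (lt_trans hq) // invf_plt ?posrE //.
      have si : 0 <= s^-1 by rewrite invr_ge0 ltW.
      by case/andP: (truncn_itv si).
    have := hs _ qs => /= h1; have := le_lt_trans (coord_le_norm _ j) h1.
    rewrite !mxE ltr_norml => /andP[h2 h3]; lra.
  apply/ler_addgt0Pr => e e0.
  pose n := Num.truncn (2 / e).
  have hn : n.+1%:R^-1 <= e / 2.
    rewrite -[e / 2]invrK lef_pV2 ?posrE ?invr_gt0 ?divr_gt0 // invf_div.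
    have ei : 0 <= 2 / e by rewrite divr_ge0 // ltW.
    by case/andP: (truncn_itv ei) => _ /ltW.
  have [N hN] := hl n.
  have e20 : 0 < e / 2 by rewrite divr_gt0.
  have := cf l (h l) (hX l); move=> /cvgrPdist_lt /(_ _ e20) /nbhs_normP[s s0 hs].
  pose b := Num.min s (N.+1%:R * (d%:R + 1))^-1.
  have N0 : 0 < N.+1%:R * (d%:R + 1) :> R by rewrite mulr_gt0 // ltr_wpDl.
  have b0 : 0 < b by rewrite /b lt_min s0 invr_gt0.
  have b20 : 0 < b / 2 by rewrite divr_gt0.
  have [y [iy yh]] : interior X `&` [set y | `|y - h l| < b / 2] !=set0.
    by apply: (Xcl _ (hX l)); apply/nbhs_normP; exists (b / 2).
  have [s' s'0 hs'] := open_normP (open_interior X) iy.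
  have m0 : 0 < Num.min s' (b / 2) by rewrite lt_min s'0.
  have [q] := ratv_dense y m0; rewrite lt_min => /andP[qs' qb].
  have iq : interior X (ratv q) by exact: hs'.
  have qh : `|ratv q - h l| < b.
    have -> : ratv q - h l = (ratv q - y) + (y - h l) by rewrite addrA subrK.
    have yh' : `|y - h l| < b / 2 := yh.
    by rewrite (le_lt_trans (ler_normD _ _)) //; lra.
  have [[//|hq]|hq] := hN q.
    exfalso; have := dist2 (h l) (ratv q); rewrite distrC => h1.
    have : d%:R * `|ratv q - h l| < N.+1%:R^-1.
      apply: (@le_lt_trans _ _ (d%:R * (N.+1%:R * (d%:R + 1))^-1)).
        by rewrite ler_wpM2l // ltW // (lt_le_trans qh) // /b ge_min lexx orbT.
      have d10 : 0 < d%:R + 1 :> R by rewrite ltr_wpDl.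
      by rewrite invfM mulrCA gtr_pMr ?invr_gt0 // ltr_pdivrMr // mul1r ltrDl.
    by rewrite ltNge; move/negP; apply; exact: le_trans hq h1.
  case: hq => _ hq.
  have qs : `|ratv q - h l| < s by rewrite (lt_le_trans qh) // /b ge_min lexx.
  have := hs _ qs => /= h1; have := le_lt_trans (coord_le_norm _ j) h1.
  rewrite !mxE ltr_norml => /andP[h2 h3]; move: hq hn; set u := n.+1%:R^-1; lra.
apply: measurable_forall => n; apply: measurable_exists => N; apply: measurable_forall => q.
apply: measurable_orP; last first.
  have [iq|nq] := pselect (interior X (ratv q)).
    apply: measurable_andP; first exact: measurable_cstP.
    by apply: measurable_le => //; apply: mf; exact: interior_subset.
  rewrite (_ : [set l | _] = set0) //; apply/seteqP; split=> // l [] //.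
apply: measurable_orP; first exact: measurable_cstP.
apply: measurable_le => //; apply: measurable_sum => i.
by apply: measurableT_comp => //; apply: measurable_funB => //; exact: mh.
Qed.

End evaluation.

Section zero_one.
Context {R : realType} {dL : measure_display} {Lam : measurableType dL}.
Variables (m : probability Lam R) (T : Lam -> Lam).

Lemma iter_measurable n : measurable_fun setT T -> measurable_fun setT (iter n T).
Proof.
move=> mT; elim: n => [|n IH]; first exact: measurable_id.
exact: (measurableT_comp mT IH).
Qed.

Lemma ae_iter (P : Lam -> Prop) : invertible_mpt m T ->
  {ae m, forall l, P l} -> {ae m, forall l, forall n, P (iter n T l)}.
Proof.
move=> [mT _ hm] [N [mN N0 PN]]; apply: ae_foralln => n.
exists (iter n T @^-1` N); split.
- by rewrite -[X in measurable X]setTI; apply: iter_measurable.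
- elim: n => [//|n IH].
  have mA : measurable (iter n T @^-1` N).
    by rewrite -[X in measurable X]setTI; apply: iter_measurable.
  have -> : iter n.+1 T @^-1` N = T @^-1` (iter n T @^-1` N).
    by apply/seteqP; split=> l; rewrite /preimage /= -iterS iterSr.
  exact: etrans (hm _ mA) IH.
- by move=> l /= hl; apply: PN.
Qed.

Lemma ae_forall_countable {J : countType} (P : J -> Lam -> Prop) :
  (forall i, {ae m, forall l, P i l}) -> {ae m, forall l, forall i, P i l}.
Proof.
move=> h; have h1 : {ae m, forall l, forall n : nat, if unpickle n is Some i then P i l else True}.
  by apply: ae_foralln => n; case: (unpickle n) => [i|]; [exact: h|exact: aeW].
by apply: filterS h1 => l hl i; have := hl (pickle i); rewrite pickleK.
Qed.

(** The set of points visiting [G] infinitely often is strictly invariant. *)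
Lemma zero_one (G : Lam -> Prop) : invertible_mpt m T -> ergodic m T ->
  measurable [set l | G l] ->
  {ae m, forall l, G (T l) <-> G l} ->
  {ae m, forall l, G l} \/ {ae m, forall l, ~ G l}.
Proof.
move=> hT hE mG /(ae_iter hT) inv.
have [mT _ _] := hT.
pose A : set Lam := [set l | forall n : nat, exists k, (n <= k)%N /\ G (iter k T l)].
have mA : measurable A.
  apply: measurable_forall => n; apply: measurable_exists => k.
  apply: measurable_andP; first exact: measurable_cstP.
  rewrite (_ : [set l | _] = iter k T @^-1` [set l | G l]) //.
  by rewrite -[X in measurable X]setTI; apply: iter_measurable.
have TA : T @^-1` A = A.
  apply/seteqP; split=> l /= hl n.
    by have [k [nk Gk]] := hl n; exists k.+1; split; [exact: leqW|rewrite iterSr].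
  have [[|k] [nk Gk]] := hl n.+1; first by [].
  by exists k; split; [exact: nk|rewrite -iterSr].
have iff : {ae m, forall l, A l <-> G l}.
  apply: filterS inv => l hl.
  have hk k : G (iter k T l) <-> G l.
    by elim: k => [//|k IH]; rewrite iterS (hl k).
  split=> [hA|Gl n]; first by have [k [_ /hk]] := hA 0%N.
  by exists n; split=> //; apply/hk.
have [A0|A1] := hE A mA TA; [right|left].
  have : {ae m, forall l, ~ A l}.
    by exists A; split=> // l /= /contrapT.
  by move=> h; apply: filterS2 iff h => l -> .
have : {ae m, forall l, A l}.
  exists (~` A); split=> //; first exact: measurableC.
  by rewrite probability_setC // A1 subee.
by move=> h; apply: filterS2 iff h => l -> .
Qed.

End zero_one.

Section random.
Context {R : realType} {d : nat} {I : countType} {dL : measure_display} {Lam : measurableType dL}.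
Local Notation V := 'rV[R]_d.
Variables (i0 : 'I_d) (T : Lam -> Lam) (X Vs : set V) (K eta : R) (phi : Lam -> I -> V -> V).
Hypothesis mT : measurable_fun setT T.
Hypothesis mphi : forall (i : I) (x : V) (j : 'I_d), X x ->
     measurable_fun setT (fun lam => phi lam i x ord0 j).
Hypothesis Hphi : forall lam, NCIFS X Vs K eta (Phi_of T phi lam).
Hypothesis Xcl : X = closure (interior X).

Local Notation Phi l := (Phi_of T phi l).

Let XV : X `<=` Vs.
Proof. by move=> x; have l := @point Lam; case: (Hphi l) => _ _ [[]] _ _ h _ _ _; exact: h. Qed.

Lemma compL_continuous l j w x : X x -> {for x, continuous (compL (Phi l) j w)}.
Proof.
by move=> Xx; have [c [/differentiable_continuous]] := compL_conformal_ex (Hphi l) j w (XV Xx).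
Qed.

(** The outer map is evaluated at a point that itself depends on the parameter, so measurability at
    fixed points must be upgraded by [measurable_eval]. *)
Lemma compL_measurable j w x (k : 'I_d) : X x ->
  measurable_fun setT (fun l => compL (Phi l) j w x ord0 k).
Proof.
move=> Xx; elim: w j k => [|a w IH] j k /=; first exact: measurable_cst.
apply: (@measurable_eval R d dL Lam X (fun l => Phi l j.+1 a) (fun l => compL (Phi l) j.+1 w x)).
- by rewrite -Xcl.
- move=> q i Xq; rewrite /Phi_of.
  exact: (measurableT_comp (mphi a i Xq) (iter_measurable j.+1 mT)).
- by move=> l q Xq; exact: (@compL_continuous l j [:: a] q Xq).
- by move=> l; apply: (compL_X (Hphi l)).
- by move=> i; exact: IH.
Qed.

Lemma enorm_continuous : continuous (@enorm R d).
Proof.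
move=> v; apply: (@continuous_comp _ _ _ (fun v : V => \sum_(i < d) v ord0 i ^+ 2) Num.sqrt).
  apply: continuous_bigsum => i; apply: (@continuous_comp _ _ _ (fun v : V => v ord0 i) (fun y => y ^+ 2)).
    exact: coord_continuous.
  exact: exprn_continuous.
exact: sqrt_continuous.
Qed.

Variable x0 : V.
Hypothesis ix0 : interior X x0.

(** By conformality a single direction [e] determines the derivative norm, as a limit of difference
    quotients. The steps 1/(n+n0+1) are small enough to stay in [X], where the compositions are
    measurable. *)
Lemma dnorm_measurable w :
  measurable_fun setT (fun l => dnorm (compL (Phi l) 0 w) x0).
Proof.
have [s s0 hs] := (nbhs_normP x0 X).1 ix0.
have Xx0 : X x0 by exact: interior_subset ix0.
pose e : V := delta_mx ord0 i0.
have ne : `|e| <= 1.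
  apply: norm_le_coord => // j; rewrite mxE eqxx /=.
  by case: (_ == _); rewrite ?normr1 ?normr0.
pose n0 := Num.truncn s^-1.
pose h n : R := (n + n0).+1%:R^-1.
have h0 n : 0 < h n by rewrite /h invr_gt0.
have hs' n : h n < s.
  have si : 0 <= s^-1 by rewrite invr_ge0 ltW.
  rewrite /h invf_plt ?posrE //; case/andP: (truncn_itv si) => _ /lt_le_trans; apply.
  by rewrite ler_nat ltnS leq_addl.
have Xh n : X (h n *: e + x0).
  apply: hs; rewrite addrK normrZ gtr0_norm // (le_lt_trans _ (hs' n)) //.
  by rewrite ler_piMr // ltW.
apply: (@measurable_fun_cvg _ _ _ setT (fun n l => enorm ((h n)^-1 *: (compL (Phi l) 0 w (h n *: e + x0) - compL (Phi l) 0 w x0)))).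
  move=> n; rewrite /enorm; apply: measurableT_comp => //.
    by apply: continuous_measurable_fun; exact: sqrt_continuous.
  apply: measurable_sum => j; apply: measurable_funX.
  under eq_fun do rewrite !mxE.
  by apply: measurable_funM => //; apply: measurable_funB; apply: compL_measurable.
move=> l _; have [df c0 hc] := compL_conformal i0 (Hphi l) 0 w (XV Xx0).
have E : dnorm (compL (Phi l) 0 w) x0 = enorm ('d (compL (Phi l) 0 w) x0 e).
  by rewrite hc enorm_delta mulr1.
rewrite E.
suff S : (fun n => (h n)^-1 *: (compL (Phi l) 0 w (h n *: e + x0) - compL (Phi l) 0 w x0)) @ \oo -->
    'd (compL (Phi l) 0 w) x0 e.
  exact: (cvg_comp _ _ S (@enorm_continuous ('d (compL (Phi l) 0 w) x0 e))).
have := @diff_derivable _ _ _ (compL (Phi l) 0 w) x0 e df.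
rewrite /derivable => /cvg_ex[v hv].
have Ev : v = 'd (compL (Phi l) 0 w) x0 e.
  by rewrite -deriveE //; apply/esym/cvg_lim; [exact: norm_hausdorff|exact: hv].
rewrite -Ev; apply/cvgrPdist_lt => ep ep0.
move: hv => /cvgrPdist_lt /(_ ep ep0) [del /= del0 hdel].
pose n1 := Num.truncn del^-1.
exists n1 => // n /= n1n.
have := hdel (h n); rewrite /= sub0r normrN gtr0_norm //; apply.
  have di : 0 <= del^-1 by rewrite invr_ge0 ltW.
  rewrite /h invf_plt ?posrE //; case/andP: (truncn_itv di) => _ /lt_le_trans; apply.
  by rewrite ler_nat ltnS (leq_trans n1n) // leq_addr.
exact: lt0r_neq0.
Qed.

Local Notation Dw l := (fun j w => Dnorm X (compL (Phi l) j w)).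
Local Notation K1 := (Num.max 1 K).

Lemma Dw_quasi_mult l : quasi_mult (Dw l) K1.
Proof.
have Xne : X !=set0 by exists x0; exact: interior_subset ix0.
split.
- exact: K1_ge1.
- by move=> j w; exact: (Dnorm_gt0 i0 (Hphi l) Xne).
- by move=> j; exact: (Dnorm_nil i0 (Hphi l) Xne).
- by move=> j u v; exact: (Dnorm_cat_le i0 (Hphi l) Xne).
- by move=> j u v; exact: (Dnorm_cat_ge i0 (Hphi l) Xne).
Qed.

Lemma Dw_shift l j w : Dw l j.+1 w = Dw (T l) j w.
Proof.
congr (Dnorm X _); elim: w j => //= a w IH j.
by rewrite IH /Phi_of -!iterSr.
Qed.

(** Distortion changes each weight by a bounded factor only, which leaves the exponential rate
    intact; the right-hand condition involves one point instead of a supremum over [X]. *)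
Lemma growth_le_dnorm l t c : 0 <= t ->
  growth_le (Dw l) t c <-> growth_le (fun _ w => dnorm (compL (Phi l) 0 w) x0) t c.
Proof.
move=> t0; have Xx0 : X x0 by exact: interior_subset ix0.
have Xne : X !=set0 by exists x0.
have dn0 w : 0 < dnorm (compL (Phi l) 0 w) x0.
  by apply: (dnorm_compL_gt0 i0 (Hphi l)); exact: XV.
have D0 w : 0 < Dw l 0 w by exact: (Dnorm_gt0 i0 (Hphi l) Xne).
have K0 : 0 < K1 by exact: K1_gt0.
split=> h del N del0.
  have [n [Nn n0 hn]] := h del N del0; exists n; split=> // F uF.
  apply: le_trans (hn F uF); apply: ler_sum => w _.
  apply: ge0_ler_powR; rewrite ?nnegrE ?(ltW (dn0 w)) ?(ltW (D0 w)) //.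
  exact: (dnorm_le_Dnorm i0 (Hphi l)).
have d20 : 0 < del / 2 by rewrite divr_gt0.
have [N1 hN1] := expR_absorb (K1 `^ t) del0.
have [n [Nn n0 hn]] := h (del / 2) (maxn N N1) d20.
have /andP[Nn1 Nn2] : (N <= n)%N && (N1 <= n)%N by move: Nn; rewrite geq_max.
exists n; split=> // F uF.
apply: (@le_trans _ _ (K1 `^ t * expR ((c + del / 2) * n%:R))).
  apply: le_trans (ler_wpM2l (powR_ge0 _ _) (hn F uF)).
  rewrite /psum mulr_sumr; apply: ler_sum => w _.
  rewrite -powRM ?(ltW K0) ?(ltW (dn0 w)) //.
  apply: ge0_ler_powR; rewrite ?nnegrE ?mulr_ge0 ?(ltW (dn0 w)) ?(ltW (D0 w)) ?(ltW K0) //.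
  by apply: (Dnorm_le_dnorm i0 (Hphi l) Xne); exact: XV.
have -> : (c + del / 2) * n%:R = c * n%:R + del / 2 * n%:R by rewrite mulrDl.
have -> : (c + del) * n%:R = c * n%:R + del * n%:R by rewrite mulrDl.
by rewrite !expRD mulrCA ler_wpM2l ?expR_ge0 //; exact: hN1.
Qed.

(** Tolerances 1/(k+1) suffice, which leaves only countable quantifiers for the measurability
    proof. *)
Lemma growth_le_nat (D : nat -> seq I -> R) t c : growth_le D t c <->
  forall k N : nat, exists n, ((N <= n)%N /\ (0 < n)%N) /\
    forall F, uniq F -> psum D F 0 n t <= expR ((c + k.+1%:R^-1) * n%:R).
Proof.
split=> [h k N|h del N del0].
  have [|n [Nn n0 hn]] := h k.+1%:R^-1 N; first by rewrite invr_gt0.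
  by exists n.
pose k := Num.truncn del^-1.
have di : 0 <= del^-1 by rewrite invr_ge0 ltW.
have kd : k.+1%:R^-1 <= del.
  by rewrite invf_ple ?posrE //; case/andP: (truncn_itv di) => _ /ltW.
have [n [[Nn n0] hn]] := h k N; exists n; split=> // F uF.
by apply: le_trans (hn F uF) _; rewrite ler_expR ler_wpM2r // lerD2l.
Qed.

Lemma growth_measurable t c : 0 <= t -> measurable [set l | growth_le (Dw l) t c].
Proof.
move=> t0; rewrite (_ : [set l | _] = [set l | forall k N : nat, exists n, ((N <= n)%N /\ (0 < n)%N) /\
    forall F, uniq F -> psum (fun _ w => dnorm (compL (Phi l) 0 w) x0) F 0 n t <=
      expR ((c + k.+1%:R^-1) * n%:R)]); last first.
  by apply/seteqP; split=> l /= h; [apply/growth_le_nat/growth_le_dnorm|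
    apply/growth_le_dnorm => //; apply/growth_le_nat].
apply: measurable_forall => k; apply: measurable_forall => N; apply: measurable_exists => n.
apply: measurable_andP; first exact: measurable_cstP.
apply: measurable_forall => F.
have [uF|nuF] := boolP (uniq F); last first.
  by rewrite (_ : [set l | _] = setT) //; apply/seteqP; split.
rewrite (_ : [set l | _] = [set l | psum (fun _ w => dnorm (compL (Phi l) 0 w) x0) F 0 n t <=
      expR ((c + k.+1%:R^-1) * n%:R)]); last first.
  by apply/seteqP; split=> l /=; [apply|].
apply: measurable_le => //; rewrite /psum; apply: measurable_sum => w.
apply: (measurableT_comp (measurable_powR t)); exact: dnorm_measurable.
Qed.

Lemma lower_pressure_leP l t (c : R) :
  (lower_pressure X (Phi l) t <= c%:E)%E <-> growth_le (Dw l) t c.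
Proof. exact: pressure_leP. Qed.

Lemma lower_pressure_measurable t : 0 <= t ->
  measurable_fun setT (fun l => lower_pressure X (Phi l) t).
Proof.
move=> t0; apply: emeasurable_fun_le => c.
rewrite (_ : [set l | _] = [set l | growth_le (Dw l) t c]); first exact: growth_measurable.
by apply/seteqP; split=> l /lower_pressure_leP.
Qed.

End random.

(** * Bowen's formula *)

Section integral_sign.
Context {R : realType} {dL : measure_display} {Lam : measurableType dL}.
Variables (m : probability Lam R).

Lemma ae_ex (P : Lam -> Prop) : {ae m, forall l, P l} -> exists l, P l.
Proof.
move=> [N [mN N0 PN]]; apply: contrapT => h.
have NT : N = setT.
  by apply/seteqP; split=> // l _; apply: PN => /= Pl; apply: h; exists l.
have := probability_setT m; rewrite -NT.
have -> : m N = 0%E by exact: N0.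
by move=> /eqP; rewrite eq_sym onee_eq0.
Qed.

Lemma integral_le0_ae (f : Lam -> \bar R) : measurable_fun setT f ->
  {ae m, forall l, (f l <= 0)%E} -> (\int[m]_l f l <= 0)%E.
Proof.
move=> mf fle; rewrite integralE.
have -> : (\int[m]_l f^\+ l = 0)%E.
  rewrite (ae_eq_integral (cst 0%E)) ?integral0 //; first exact: measurable_funepos.
  apply: filterS fle => l fl _ /=; rewrite funeposE; exact/max_idPr.
by rewrite sub0e leeNl oppe0; apply: integral_ge0.
Qed.

(** No integrability is assumed: the negative part integrates to 0, and the integral of the positive
    part may be infinite. *)
Lemma integral_gt0_ae (f : Lam -> \bar R) : measurable_fun setT f ->
  {ae m, forall l, (0 < f l)%E} -> (0 < \int[m]_l f l)%E.
Proof.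
move=> mf fgt; rewrite integralE.
have -> : (\int[m]_l f^\- l = 0)%E.
  rewrite (ae_eq_integral (cst 0%E)) ?integral0 //; first exact: measurable_funeneg.
  apply: filterS fgt => l fl _ /=; rewrite funenegE; apply/max_idPr.
  by rewrite leeNl oppe0 ltW.
rewrite sube0 lt_neqAle integral_ge0 // andbT; apply/negP => /eqP/esym h.
have mfp : measurable_fun setT (f^\+)%E by exact: measurable_funepos.
have [h1 _] := ae_eq_integral_abs m measurableT mfp.
have h0 : (\int[m]_l `|f^\+ l| = 0)%E.
  by rewrite -[RHS]h; apply: eq_integral => l _; rewrite gee0_abs.
have h2 : {ae m, forall l, f^\+%E l = 0%E /\ (0 < f l)%E}.
  by apply: filterS2 (h1 h0) fgt => l hl fl; split=> //; exact: hl.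
have [l [hl fl]] := ae_ex h2.
have : (f l <= f^\+ l)%E by rewrite funeposE le_max lexx.
by rewrite hl leNgt fl.
Qed.

End integral_sign.

Lemma hausdorff_measure_subsingleton {R : realType} {d : nat} (A : set 'rV[R]_d) s : 0 < s ->
  (forall x y, A x -> A y -> x = y) -> hausdorff_measure s A = 0%E.
Proof.
move=> s0 hA; apply/hausdorff_measure_eq0P => delta e delta0 e0.
have dA : ediam A = 0%E.
  apply/eqP; rewrite eq_le ediam_ge0 andbT; apply: ediam_le => // x y Ax Ay.
  by rewrite (hA x y Ax Ay) subrr enorm0.
have d0 : ediam (@set0 'rV[R]_d) = 0%E.
  by apply/eqP; rewrite eq_le ediam_ge0 andbT; apply: ediam_le.
exists (fun k => if k == 0%N then A else set0); split.
- by move=> x Ax; exists 0%N.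
- by move=> k; case: ifP => _; rewrite ?dA ?d0 lee_fin ltW.
- rewrite eseries0 ?lte_fin // => k _ _.
  by case: ifP => _; rewrite ?dA ?d0 /= powR0 // gt_eqF.
Qed.

Section bowen.
Context {R : realType} {d : nat} {I : countType} {dL : measure_display} {Lam : measurableType dL}.
Local Notation V := 'rV[R]_d.
Variables (m : probability Lam R) (T : Lam -> Lam) (X Vs : set V) (K eta : R)
  (phi : Lam -> I -> V -> V).
Hypothesis cX : compact X.
Hypothesis Xcl : X = closure (interior X).
Hypothesis Xreg : smooth_boundary X \/ convex_body X.
Hypothesis hT : invertible_mpt m T.
Hypothesis hE : ergodic m T.
Hypothesis mphi : forall (i : I) (x : V) (j : 'I_d), X x ->
     measurable_fun setT (fun lam => phi lam i x ord0 j).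
Hypothesis Hphi : forall lam, NCIFS X Vs K eta (Phi_of T phi lam).
Hypothesis Hinf : infinite_set [set: I] ->
     exists C : R, forall i : I,
       (0 < M_lower m X phi i)%E /\ (M_upper m X phi i <= C%:E * M_lower m X phi i)%E.

Local Notation Phi l := (Phi_of T phi l).
Local Notation Dw l := (fun j w => Dnorm X (compL (Phi l) j w)).
Local Notation J l := (limit_set X (Phi l)).
Local Notation K1 := (Num.max 1 K).

Section nondegenerate.
Variables (i0 : 'I_d) (x0 : V).
Hypothesis ix0 : interior X x0.

Let Xne : X !=set0. Proof. by exists x0; exact: interior_subset ix0. Qed.
Let mT : measurable_fun setT T. Proof. by case: hT. Qed.
Let HD l : quasi_mult (Dw l) K1. Proof. exact: (Dw_quasi_mult i0 Hphi ix0). Qed.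

(** With an empty alphabet [eta] may be nonpositive, and any ratio serves; a letter forces
    [eta > 0], since it bounds a positive norm. *)
Lemma contraction_ratio : exists2 c, 0 < c < 1 & forall l w, Dw l 0%N w <= c ^+ size w.
Proof.
have [[i _]|nI] := pselect (exists i : I, True); last first.
  exists (1 / 2); first by lra.
  move=> l [|a w]; last by exfalso; apply: nI; exists a.
  by rewrite (Dnorm_nil i0 (Hphi l) Xne) expr0.
exists eta; last by move=> l w; exact: (Dnorm_le_eta i0 (Hphi l) Xne).
have l := @point Lam.
have e1 : eta < 1 by case: (Hphi l) => _ _ _ _ [].
rewrite e1 andbT; have := Dnorm_le_eta i0 (Hphi l) Xne 0 [:: i].
by rewrite expr1; apply: lt_le_trans; exact: (Dnorm_gt0 i0 (Hphi l) Xne).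
Qed.

Lemma exists_corkscrew : exists2 a : R, 0 < a & corkscrew X a.
Proof.
case: Xreg => [sX|cvX]; first exact: corkscrew_smooth.
by apply: corkscrew_convex => //; exists x0.
Qed.

Definition comparable_orbit (a : I -> R) (C : R) l : Prop :=
  forall j i, a i <= Dw l j [:: i] <= C * a i.

(** Countably many letters and the invariance of null sets under [T] make the essential bounds hold
    along almost every whole orbit, with [a] and [C] independent of the orbit. *)
Lemma infinite_comparable : infinite_set [set: I] ->
  exists a C, (forall i, 0 < a i) /\ {ae m, forall l, comparable_orbit a C l}.
Proof.
move=> /Hinf[C hC].
have h1 : {ae m, forall l, forall i, (M_lower m X phi i <= (Dnorm X (phi l i))%:E)%E}.
  by apply: ae_forall_countable => i; exact: ess_inf_le.
have h2 : {ae m, forall l, forall i, ((Dnorm X (phi l i))%:E <= M_upper m X phi i)%E}.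
  by apply: ae_forall_countable => i; exact: ess_sup_ge.
have [l0 hl0] := ae_ex h1.
pose a i := fine (M_lower m X phi i).
have aE i : M_lower m X phi i = (a i)%:E.
  rewrite /a fineK // ge0_fin_numE; last exact: ltW (hC i).1.
  by apply: le_lt_trans (hl0 i) _; rewrite ltry.
exists a, C; split.
  by move=> i; rewrite -lte_fin -aE; exact: (hC i).1.
have h12 : {ae m, forall l, (forall i, (M_lower m X phi i <= (Dnorm X (phi l i))%:E)%E) /\
    (forall i, ((Dnorm X (phi l i))%:E <= M_upper m X phi i)%E)}.
  exact: filterI h1 h2.
have := ae_iter hT h12; apply: filterS => l hl j i.
have [q1 q2] := hl j.+1; apply/andP; split; first by rewrite -lee_fin -aE; exact: q1.
by rewrite -lee_fin EFinM -aE; apply: le_trans (q2 i) (hC i).2.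
Qed.

Lemma finite_enum : ~ infinite_set [set: I] -> exists2 F : seq I, uniq F & forall i, i \in F.
Proof.
move=> /contrapT finI; exists (finmap.enum_fset (fset_set [set: I])); first exact: finmap.fset_uniq.
by move=> i; have := in_fset_set finI i; rewrite [RHS]mem_setT => ->.
Qed.

Lemma growth_invariant t : 0 <= t ->
  {ae m, forall l, growth_le (Dw (T l)) t 0 <-> growth_le (Dw l) t 0}.
Proof.
move=> t0.
have E l : Dw (T l) = shiftw (Dw l).
  by apply/funext => j; apply/funext => w; rewrite /shiftw (Dw_shift T X phi l).
have [[i _]|nI] := pselect (exists i : I, True); last first.
  apply: aeW => l; have G l' : growth_le (Dw l') t 0.
    move=> del N del0; exists N.+1; split=> // F _.
    case: F => [|a F]; last by exfalso; apply: nI; exists a.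
    by rewrite /psum /= big_nil expR_ge0.
  by split=> _; exact: G.
have inI : inhabited I := inhabits i.
have GE l : growth_le (shiftw (Dw l)) t 0 -> growth_le (Dw (T l)) t 0.
  by case: _ / (E l).
have GE' l : growth_le (Dw (T l)) t 0 -> growth_le (shiftw (Dw l)) t 0.
  by case: _ / (E l).
have fwd l : growth_le (Dw l) t 0 -> growth_le (Dw (T l)) t 0.
  by move=> h; apply: GE; exact: (growth_le_shift (HD l) t0 inI h).
have [infI|/finite_enum[F uF hF]] := pselect (infinite_set [set: I]); last first.
  apply: aeW => l; split; last exact: fwd.
  move=> /GE'; apply: (@growth_le_unshift _ _ _ _ (HD l) t (psum (Dw l) F 0 1 t) t0).
  by move=> G uG; apply: psum_mono => // b _; exact: hF.
have [a [C [a0 hab]]] := infinite_comparable infI.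
apply: filterS hab => l hl; split; last exact: fwd.
move=> /GE' hG.
(* A bound on one level sum of [T l] bounds its first level sum, and comparability of the letters
   carries this bound back to the first level of [l]. *)
have [n [_ n0 hn]] := hG 1 1%N ltr01.
have [y' hy'] := psum_bounded_first (shiftw_quasi_mult (HD l)) t0 inI n0 hn.
apply: (@growth_le_unshift _ _ _ _ (HD l) t (C `^ t * y') t0) => // F uF.
apply: le_trans (psum_le_sig (HD l) a0 hl t0 F 0) _.
rewrite ler_wpM2l ?powR_ge0 //; apply: le_trans (hy' F uF).
exact: (sig_le_psum (HD l) a0 hl t0 F 1).
Qed.

Lemma expected_pressure_sign t : 0 <= t ->
  ((expected_pressure m T X phi t <= 0)%E /\ {ae m, forall l, growth_le (Dw l) t 0}) \/
  ((0 < expected_pressure m T X phi t)%E /\ {ae m, forall l, ~ growth_le (Dw l) t 0}).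
Proof.
move=> t0.
have mP := lower_pressure_measurable i0 mT mphi Hphi Xcl ix0 t0.
have := zero_one hT hE (growth_measurable i0 mT mphi Hphi Xcl ix0 0 t0) (growth_invariant t0).
move=> [h|h]; [left|right]; split=> //.
  apply: integral_le0_ae => //; apply: filterS h => l hl.
  exact/lower_pressure_leP.
apply: integral_gt0_ae => //; apply: filterS h => l hl.
by rewrite ltNge; apply/negP => /(lower_pressure_leP T X phi l t 0).
Qed.

Lemma expected_pressure_le0 t : 0 <= t -> (expected_pressure m T X phi t <= 0)%E ->
  {ae m, forall l, growth_le (Dw l) t 0}.
Proof.
move=> t0 h; have [[_ hG]|[h' _]] := expected_pressure_sign t0; first exact: hG.
by have := lt_le_trans h' h; rewrite ltxx.
Qed.

Lemma hausdorff_upper l q s : 0 <= q < s -> growth_le (Dw l) q 0 ->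
  hausdorff_measure s (J l) = 0%E.
Proof.
move=> /andP[q0 qs] hG.
have [c c01 hc] := contraction_ratio.
have [M M0 hM] := compL_diam i0 (Hphi l) Xne cX.
apply: (@hausdorff_measure0 R d I X (Phi l) (Dw l) M c) => //.
- by move=> w; exact: (Dnorm_gt0 i0 (Hphi l) Xne).
- by move=> w x y; exact: hM.
- by rewrite (le_lt_trans q0).
- by apply: (growth_le_small (HD l)) hG => //; rewrite q0.
Qed.

Lemma hausdorff_lower l s : 0 < s ->
  (infinite_set [set: I] -> exists a C, (forall i, 0 < a i) /\ comparable_orbit a C l) ->
  ~ growth_le (Dw l) s 0 -> hausdorff_measure s (J l) <> 0%E.
Proof.
move=> s0 hinf nG.
have [F [g [C0 [uF g1 C00 hg]]]] : exists F g C0, [/\ uniq F, 1 < g, 0 < C0 &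
    forall n, C0 * g ^+ n <= psum (Dw l) F 0 n s].
  have [infI|/finite_enum[F uF hF]] := pselect (infinite_set [set: I]); last first.
    exact: (finite_growth (HD l) uF).
  have [a [C [a0 ha]]] := hinf infI.
  apply: (infinite_growth (HD l) a0 ha (ltW s0) _ nG).
  apply: contrapT => nI; apply: infI.
  by rewrite (_ : [set: I] = set0) //; apply/seteqP; split=> // i _; exfalso; apply: nI; exact: inhabits.
have [c c01 hc] := contraction_ratio.
have [a a0 ha] := exists_corkscrew.
have [N hN] := cylinder_count i0 (Hphi l) Xne cX a0 ha.
have XV : X `<=` Vs by case: (Hphi l) => _ _ [[]].
apply: (@hausdorff_measure_gt0 R d I X (Phi l) (Dw l) K1 c (HD l) (hc l) c01 cX Xne _ _ N _ F s g C0) => //.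
- by move=> j w x; apply: (compL_X (Hphi l)).
- move=> j w x Xx; have [b [/differentiable_continuous]] := compL_conformal_ex (Hphi l) j w (XV x Xx).
  by [].
- by move=> n x r W; exact: hN.
Qed.

(** One null set serves all exponents: the sign of the pressure is compared only at rational
    exponents, and a rational inserted in each strict inequality, with [Gmono], does the rest. *)
Lemma bowen_nondegenerate :
  {ae m, forall l, hausdorff_dim (J l) =
     ereal_inf [set t%:E | t in [set t : R | 0 <= t /\ (expected_pressure m T X phi t <= 0)%E]]}.
Proof.
have [c /andP[c0 c1] hc] := contraction_ratio.
have Gmono l q s : 0 <= q <= s -> growth_le (Dw l) q 0 -> growth_le (Dw l) s 0.
  move=> qs; apply: (growth_le_mono (HD l) qs (hc l)).
  by rewrite (ltW c0) (ltW c1).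
have h1 : {ae m, forall l, forall q : rat, 0 <= (ratr q : R) ->
    (growth_le (Dw l) (ratr q) 0 <-> (expected_pressure m T X phi (ratr q) <= 0)%E)}.
  apply: ae_forall_countable => q.
  have [q0|q0] := boolP (0 <= (ratr q : R)); last by apply: aeW => l.
  case: (expected_pressure_sign q0) => [[h hG]|[h hG]].
    by apply: filterS hG => l Gl _; split=> _; [exact: h|exact: Gl].
  apply: filterS hG => l Gl _; split=> h'; first by case: (Gl h').
  by have := lt_le_trans h h'; rewrite ltxx.
have h2 : {ae m, forall l, infinite_set [set: I] -> exists a C, (forall i, 0 < a i) /\ comparable_orbit a C l}.
  have [infI|nI] := pselect (infinite_set [set: I]); last by apply: aeW => l /nI.
  by have [a [C [a0]]] := infinite_comparable infI; apply: filterS => l hl _; exists a, C.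
apply: filterS2 h1 h2 => l h1 h2.
apply/eqP; rewrite eq_le; apply/andP; split.
  apply: le_ereal_inf_tmp => _ [t [t0 EPt] <-].
  apply: hausdorff_dim_le => [|s]; first by rewrite lee_fin.
  rewrite lte_fin => /rat_in_itvoo[q]; rewrite in_itv /= => /andP[tq qs].
  have q0 : 0 <= (ratr q : R) by rewrite (le_trans t0) // ltW.
  apply: (@hausdorff_upper l (ratr q)); first by rewrite q0.
  apply/(h1 q q0).
  have hG := expected_pressure_le0 t0 EPt.
  have [[EPq _]|[_ hG']] := expected_pressure_sign q0; first exact: EPq.
  (* Monotonicity in the exponent holds for each parameter, so one parameter satisfying both almost
     sure statements is contradictory. *)
  have [l' [Gt nG]] : exists l', growth_le (Dw l') t 0 /\ ~ growth_le (Dw l') (ratr q) 0.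
    by apply: (@ae_ex _ _ _ m); exact: filterI hG hG'.
  by exfalso; apply: nG; apply: Gmono Gt; rewrite t0 ltW.
apply: le_ereal_inf_tmp => _ [s [s0 Hs] <-].
apply/lee_addgt0Pr => e e0; rewrite -EFinD.
have : s < s + e by rewrite ltrDl.
move=> /rat_in_itvoo[q]; rewrite in_itv /= => /andP[sq qs].
have q0 : 0 <= (ratr q : R) by rewrite ltW // (lt_trans s0).
apply: (@le_trans _ _ (ratr q)%:E); last by rewrite lee_fin ltW.
apply: ereal_inf_lbound; exists (ratr q) => //; split=> //; apply/(h1 q q0).
apply: (@Gmono l s); first by rewrite !ltW.
by apply: contrapT => nG; exact: (hausdorff_lower s0 h2 nG Hs).
Qed.

End nondegenerate.

(** Covers dimension 0 and empty [X]: all weights vanish for [t > 0], so the pressure is nonpositive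
    there and both sides are 0. *)
Lemma bowen_degenerate : (forall x y, X x -> X y -> x = y) ->
  (forall f : V -> V, Dnorm X f = 0) -> forall l, hausdorff_dim (J l) =
     ereal_inf [set t%:E | t in [set t : R | 0 <= t /\ (expected_pressure m T X phi t <= 0)%E]].
Proof.
move=> hX D0 l.
have EP t : 0 < t -> (expected_pressure m T X phi t <= 0)%E.
  move=> t0; have P l' : (lower_pressure X (Phi l') t <= 0)%E.
    apply/(lower_pressure_leP T X phi l' t 0) => del N del0; exists N.+1; split=> // F _.
    rewrite /psum big1 ?expR_ge0 // => w _.
    by rewrite D0 powR0 // gt_eqF.
  rewrite /expected_pressure integralE.
  rewrite [X in (X - _)%E](_ : _ = 0%E); last first.
    rewrite (eq_integral (cst 0%E)) ?integral0 // => l' _.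
    by rewrite funeposE; apply/max_idPr.
  by rewrite sub0e leeNl oppe0; apply: integral_ge0.
have JX : J l `<=` X by move=> x /(_ 0%N Logic.I)[w /= /size0nil -> [y Xy <-]].
transitivity (0%E : \bar R).
  apply/eqP; rewrite eq_le; apply/andP; split.
    apply: hausdorff_dim_le => // s; rewrite lte_fin => s0.
    by apply: hausdorff_measure_subsingleton => // x y /JX Xx /JX Xy; exact: hX.
  by apply: le_ereal_inf_tmp => _ [s [s0 _] <-]; rewrite lee_fin ltW.
apply/eqP; rewrite eq_le; apply/andP; split.
  by apply: le_ereal_inf_tmp => _ [s [s0 _] <-]; rewrite lee_fin.
apply/lee_addgt0Pr => e e0; rewrite add0e; apply: ereal_inf_lbound; exists e => //.
by split; [exact: ltW|exact: EP].
Qed.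

End bowen.

Lemma dnorm_dim0 {R : realType} {d : nat} (f : 'rV[R]_d -> 'rV[R]_d) x :
  ~ (exists i : 'I_d, True) -> dnorm f x = 0.
Proof.
move=> nd; have e0 (u : 'rV[R]_d) : enorm u = 0.
  by rewrite /enorm big1 ?sqrtr0 // => i _; exfalso; apply: nd; exists i.
rewrite /dnorm (_ : [set _ | _ in _] = [set 0]) ?sup1 //.
apply/seteqP; split=> [_ [u _ <-] /=|_ -> /=]; first by rewrite e0.
by exists 0 => //=; rewrite e0.
Qed.

Theorem theorem9p1 (R : realType) (d : nat) (X : set 'rV[R]_d)
  (dL : measure_display) (Lam : measurableType dL) (m : probability Lam R)
  (T : Lam -> Lam) (I : countType) (phi : Lam -> I -> 'rV[R]_d -> 'rV[R]_d)
  (Vs : set 'rV[R]_d) (K eta : R) :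
  compact X ->
  X = closure (interior X) ->
  smooth_boundary X \/ convex_body X ->
  invertible_mpt m T ->
  ergodic m T ->
  (forall (i : I) (x : 'rV[R]_d) (j : 'I_d), X x ->
     measurable_fun setT (fun lam => phi lam i x ord0 j)) ->
  (forall lam, NCIFS X Vs K eta (Phi_of T phi lam)) ->
  (infinite_set [set: I] ->
     exists C : R, forall i : I,
       (0 < M_lower m X phi i)%E /\ (M_upper m X phi i <= C%:E * M_lower m X phi i)%E) ->
  {ae m, forall lam,
     hausdorff_dim (limit_set X (Phi_of T phi lam)) =
     ereal_inf [set t%:E | t in [set t : R |
                  0 <= t /\ (expected_pressure m T X phi t <= 0)%E]]}.
Proof.
move=> cX Xcl Xreg hT hE mphi Hphi Hinf.
have [[i0 _]|nd] := pselect (exists i : 'I_d, True); last first.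
  have E (x y : 'rV[R]_d) : x = y.
    by apply/rowP => i; exfalso; apply: nd; exists i.
  apply: aeW => l; apply: bowen_degenerate => // f.
  have [[x Xx]|X0] := pselect (X !=set0).
    rewrite /Dnorm (_ : [set _ | _ in _] = [set 0]) ?sup1 //.
    apply/seteqP; split=> [_ [y _ <-] /=|_ -> /=]; first by rewrite dnorm_dim0.
    by exists x => //; rewrite dnorm_dim0.
  rewrite /Dnorm (_ : [set _ | _ in _] = set0) ?sup0 //.
  by apply/seteqP; split=> // _ [y Xy <-]; exfalso; apply: X0; exists y.
have [[x0 ix0]|nX] := pselect (interior X !=set0); last first.
  have X0 : X = set0.
    rewrite Xcl (_ : interior X = set0) ?closure0 //.
    by apply/seteqP; split=> // x ix; apply: nX; exists x.
  apply: aeW => l; apply: bowen_degenerate; first by rewrite X0.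
  by move=> f; rewrite /Dnorm X0 image_set0 sup0.
exact: (bowen_nondegenerate cX Xcl Xreg hT hE mphi Hphi Hinf i0 ix0).
Qed.
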